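(* Let $B=(B_t)_{t\ge 0}$ be a standard Brownian motion on a probability space $(\Omega,\mathcal F,\mathsf P)$ with $B_0=0$, let $\mu$ be a probability measure on $(\mathbb R,\mathcal B(\mathbb R))$ such that $\mu(\{0\})=0$, let $(b,c)$ be the pair of boundary functions embedding $\mu$ into $B$ (as described in the context), and let $\tau=\tau_{b,c}=\inf\{t>0 : B_t\ge b(t)\text{ or }B_t\le c(t)\}$. Then: (i) If $\int x\,\mu(dx)=0$, then $\{B_{t\wedge\tau} : t\ge 0\}$ is uniformly integrable. (ii) If $0<\int x\,\mu(dx)<+\infty$, then $\{B_{t\wedge\tau}^+ : t\ge 0\}$ is uniformly integrable. (iii) If $-\infty<\int x\,\mu(dx)<0$, then $\{B_{t\wedge\tau}^- : t\ge 0\}$ is uniformly integrable.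
   Context: $\mathbb R_+=[0,\infty)$ and $\mathbb R_-=(-\infty,0]$; $\operatorname{supp}(\mu)$ is the (closed) topological support of $\mu$; ''increasing'' and ''decreasing'' are meant in the weak sense. For real $x$, $x^+=\max(x,0)$ and $x^-=\max(-x,0)$. The conditions on $\int x\,\mu(dx)$ include that this integral is well defined. Pair of boundary functions embedding $\mu$ into $B$: functions $b,c$ on $(0,\infty)$ such that $\tau_{b,c}<\infty$ a.s., $B_{\tau_{b,c}}$ has law $\mu$, and - if $\operatorname{supp}(\mu)\subseteq\mathbb R_+$, then $b:(0,\infty)\to\mathbb R$ is left-continuous and increasing and $c\equiv-\infty$; - if $\operatorname{supp}(\mu)\subseteq\mathbb R_-$, then $b\equiv+\infty$ and $c:(0,\infty)\to\mathbb R$ is left-continuous and decreasing; - otherwise, $b:(0,\infty)\to\mathbb R\cup\{+\infty\}$ is left-continuous and increasing and $c:(0,\infty)\to\mathbb R\cup\{-\infty\}$ is left-continuous and decreasing. (Such a pair exists and is unique.) *)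

(* Defs.v *)
From HB Require Import structures.
From mathcomp Require Import all_boot all_order all_algebra.
From mathcomp Require Import all_classical all_reals all_analysis.

Set Implicit Arguments.
Unset Strict Implicit.
Unset Printing Implicit Defensive.

Import Order.TTheory GRing.Theory Num.Theory.
Import numFieldNormedType.Exports.

Local Open Scope classical_set_scope.
Local Open Scope ring_scope.

(* Processes have index type R; their values at negative times are never used. *)

Section probability.
Context {d : measure_display} {T : measurableType d} {R : realType}.
Variable P : probability T R.

(* The sets [A i] may be [setT], so the product rule for the whole family
   contains the product rule for every subfamily. *)
Definition mutually_independent n (X : 'I_n -> T -> R) : Prop :=
  forall A : 'I_n -> set R, (forall i, measurable (A i)) ->
    P (\bigcap_i (X i @^-1` A i)) =
      (\big[*%E/1%E]_(i < n) P (X i @^-1` A i))%E.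

Record standard_brownian_motion (B : R -> {RV P >-> R}) : Prop := {
  brownian_start : forall w, B 0 w = 0 ;
  brownian_continuous :
    forall w, {within `[0, +oo[%classic, continuous (fun t => B t w)} ;
  brownian_gaussian : forall s t : R, 0 <= s -> s < t ->
    forall A : set R, measurable A ->
      P ((fun w => B t w - B s w) @^-1` A) =
        normal_prob 0 (Num.sqrt (t - s)) A ;
  brownian_independent : forall n (t : nat -> R), 0 <= t 0%N ->
    (forall i, (i < n)%N -> t i < t i.+1) ->
    mutually_independent (fun (i : 'I_n) w => B (t i.+1) w - B (t i) w) }.

(* sup_(i in D) E[ |X_i| ; |X_i| >= K ] --> 0 as K --> +oo *)
Definition uniformly_integrable (I : Type) (D : set I) (X : I -> T -> R) : Prop :=
  (forall i, D i -> measurable_fun setT (X i)) /\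
  (fun K : R => ereal_sup
     [set (\int[P]_(w in [set w | (K <= `|X i w|)%R]) `|X i w|%:E)%E | i in D])
    @ +oo --> 0%E.

(* tau_{b,c}; it is +oo when the boundaries are never reached. *)
Definition hitting_time (B : R -> T -> R) (b c : R -> \bar R) (w : T) : \bar R :=
  ereal_inf [set t%:E | t in
    [set t : R | 0 < t /\ ((b t <= (B t w)%:E)%E \/ ((B t w)%:E <= c t)%E)]].

(* B_{t /\ tau}; for t >= 0 and tau >= 0 the minimum is a finite number. *)
Definition stopped (B : R -> T -> R) (tau : T -> \bar R) (t : R) (w : T) : R :=
  B (fine (Order.min t%:E (tau w))) w.

End probability.

Section boundaries.
Context {R : realType}.
Implicit Types (mu : probability (measurableTypeR R) R) (b c : R -> \bar R).

Definition topological_support mu : set R :=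
  [set x | forall U : set R, open U -> U x -> (0 < mu U)%E].

(* Since +oo - +oo = -oo in [\bar R], the mean is -oo as soon as the negative
   part has infinite integral; hence [mean mu = 0], [0 < mean mu < +oo] and
   [-oo < mean mu < 0] each force the identity to be integrable. *)
Definition mean mu : \bar R := (\int[mu]_x x%:E)%E.

Definition left_continuous (f : R -> \bar R) : Prop :=
  forall t : R, 0 < t -> f s @[s --> t^'-] --> f t.

Definition increasing (f : R -> \bar R) : Prop :=
  forall s t : R, 0 < s -> s <= t -> (f s <= f t)%E.

Definition decreasing (f : R -> \bar R) : Prop :=
  forall s t : R, 0 < s -> s <= t -> (f t <= f s)%E.

Record boundary_pair mu b c : Prop := {
  boundary_nonneg : topological_support mu `<=` [set x | 0 <= x] ->
    [/\ forall t : R, 0 < t -> b t \is a fin_num,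
        left_continuous b, increasing b &
        forall t : R, 0 < t -> c t = -oo%E] ;
  boundary_nonpos : topological_support mu `<=` [set x | x <= 0] ->
    [/\ forall t : R, 0 < t -> b t = +oo%E,
        forall t : R, 0 < t -> c t \is a fin_num,
        left_continuous c & decreasing c] ;
  boundary_two_sided :
    ~ (topological_support mu `<=` [set x | 0 <= x]) ->
    ~ (topological_support mu `<=` [set x | x <= 0]) ->
    [/\ forall t : R, 0 < t -> b t != -oo%E, left_continuous b & increasing b] /\
    [/\ forall t : R, 0 < t -> c t != +oo%E, left_continuous c & decreasing c] }.

Record embedding_pair d (T : measurableType d) (P : probability T R)
    (B : R -> {RV P >-> R}) mu b c : Prop := {
  embedding_boundary : boundary_pair mu b c ;
  embedding_finite : {ae P, forall w, (hitting_time B b c w < +oo)%E} ;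
  embedding_law : forall A : set R, measurable A ->
    P [set w | (hitting_time B b c w < +oo)%E /\
               A (B (fine (hitting_time B b c w)) w)] = mu A }.

End boundaries.

(* Main.v *)
From HB Require Import structures.
Require Import Defs.
From mathcomp Require Import all_boot all_order all_algebra.
From mathcomp Require Import ring lra.
From mathcomp Require Import all_classical all_reals all_analysis measurable_realfun.
Set Implicit Arguments.
Unset Strict Implicit.
Unset Printing Implicit Defensive.
Import Order.TTheory GRing.Theory Num.Theory.
Import numFieldNormedType.Exports.
Local Open Scope classical_set_scope.
Local Open Scope ring_scope.

(** The uniform integrability of the positive part of the stopped process comes
    down to one inequality. Let [Y] be the value at the hitting time [tau], and
    suppose that the mean of [Y] is nonnegative. If
      [E (pos (X t); t < tau) <= E (pos Y; t < tau)]   for all [t >= 0],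
    then the part of the stopped process that is still running is small in mean at
    late times, and it has bounded fourth moments at early times; the part that is
    already stopped is the integrable variable [Y]. Part (ii) is this statement,
    part (iii) is the same for the reflected process and boundaries, and part (i)
    is both together.

    The inequality is proved with a free level [x], with [pos (_ - x)] for [pos]
    ([potential_le]); write [D t x] for its right-hand side minus its left-hand
    side. As a function of time and level, [D] solves the heat equation in the
    region between the two boundaries, because the path moves freely there
    and [Y], on [t < tau], lies outside the interval that the boundaries span at
    time [t] ([hitting_value_outside]): this is where the upper boundary has to
    increase and the lower one to decrease. Beyond the upper boundary the left-hand
    side is zero. Beyond the lower boundary and at time zero, [D >= 0] follows by
    optional stopping from the nonnegative mean of [Y]. As the region expands in
    time, the maximum principle gives [D >= 0] everywhere.

    This maximum principle is carried out on a time grid ([grid_potential_bound]).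
    Between two grid times an average over the increment replaces the heat
    equation, and levels within a margin [dl] of a boundary are treated as boundary
    points; the errors vanish with the mesh, and then with [dl]. Only the
    independence of increments, their zero mean and a fourth moment bound are used.
    Optional stopping ([hitting_value_submartingale]) is obtained by rounding [tau]
    up to a grid, which requires that not having hit by time [s] be an event of
    the past of [s] ([no_hit_history]): left continuity of the boundaries makes
    this a condition at rational times. *)

Local Notation pos y := (Num.max y 0).

(** * Integration *)

Section integration.
Context {d} {T : measurableType d} {R : realType}.

Lemma ge0_integral_setD (m : {measure set T -> \bar R}) (A B : set T) (f : T -> \bar R) :
  measurable A -> measurable B -> B `<=` A -> measurable_fun A f ->
  (forall x, A x -> (0 <= f x)%E) ->
  (\int[m]_(x in A) f x = \int[m]_(x in B) f x + \int[m]_(x in A `\` B) f x)%E.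
Proof.
move=> mA mB BA mf f0.
have AE : B `|` (A `\` B) = A by rewrite setDUK.
rewrite -[in LHS]AE ge0_integral_setU//.
- exact: measurableD.
- by rewrite AE.
- by rewrite AE.
- by apply/disj_setPS => w [Bw [_ /(_ Bw)]].
Qed.

(** The law of the pair is the product of the two laws, and Tonelli's theorem
    splits an integral against it. *)
Lemma integral_indep_pair d' (T' : measurableType d') d'' (T'' : measurableType d'')
    (P : probability T R)
    (U : T -> T') (Z : T -> T'') (f : T' * T'' -> \bar R) :
  measurable_fun setT U -> measurable_fun setT Z ->
  (forall A D, measurable A -> measurable D ->
    P (U @^-1` A `&` Z @^-1` D) = P (U @^-1` A) * P (Z @^-1` D))%E ->
  measurable_fun setT f -> (forall p, 0 <= f p)%E ->
  (\int[P]_w f (U w, Z w) = \int[P]_w' \int[P]_w f (U w, Z w'))%E.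
Proof.
move=> mU mZ UZ mf f0.
pose U' : {mfun T >-> T'} := HB.pack U (isMeasurableFun.Build _ _ _ _ _ mU).
pose Z' : {mfun T >-> T''} := HB.pack Z (isMeasurableFun.Build _ _ _ _ _ mZ).
have mUZ : measurable_fun setT (fun w => (U w, Z w)).
  exact: measurable_fun_pair.
pose UZ' : {mfun T >-> (T' * T'')%type} :=
  HB.pack (fun w => (U w, Z w)) (isMeasurableFun.Build _ _ _ _ _ mUZ).
transitivity (\int[distribution P UZ']_p f p)%E.
  by rewrite ge0_integral_distribution.
transitivity (\int[distribution P U' \x distribution P Z']_p f p)%E.
  apply: eq_measure_integral => X mX _; apply/esym.
  by apply: product_measure_unique => // A D; exact: UZ.
rewrite fubini_tonelli2//.
rewrite ge0_integral_distribution//.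
- apply: eq_integral => w' _ /=; rewrite /fubini_G.
  rewrite ge0_integral_distribution//.
  by apply: measurableT_comp => //; exact: measurable_pair2.
- exact: measurable_fun_fubini_tonelli_G.
- by move=> y; exact: integral_ge0.
Qed.

(** Fatou's lemma, in the form in which limits are taken below. *)
Lemma le_integral_cvg (m : {measure set T -> \bar R}) (f : (T -> \bar R)^nat)
    (g : T -> \bar R) (M : \bar R) :
  (forall n, measurable_fun setT (f n)) -> (forall n w, 0 <= f n w)%E ->
  (forall w, f ^~ w @ \oo --> g w) ->
  (forall n, \int[m]_w f n w <= M)%E -> (\int[m]_w g w <= M)%E.
Proof.
move=> mf f0 fg fM.
rewrite (_ : (\int[m]_w g w = \int[m]_w limn_einf (f ^~ w))%E); last first.
  by apply: eq_integral => w _; rewrite (cvg_limn_einf_sup (fg w)).1.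
apply: (le_trans (fatou _ _ _ _)) => //.
rewrite limn_einf_lim; apply: lime_le; first exact: is_cvg_einfs.
apply: nearW => n; apply: le_trans (fM n).
by apply: ereal_inf_lbound; exists n => /=.
Qed.

End integration.

(** * Processes with centred independent increments *)


Section positive_part.
Context {d} {T : measurableType d} {R : realType}.

Lemma measurable_pos (D : set T) (f : T -> R) :
  measurable_fun D f -> measurable_fun D (fun w => (pos (f w))%:E).
Proof.
move=> mf; apply/measurable_EFinP; exact: measurable_maxr.
Qed.

Lemma pos_ge0 (y : R) : 0 <= pos y.
Proof. by rewrite le_max lexx orbT. Qed.

Lemma epos_ge0 (y : R) : (0 <= (pos y)%:E)%E.
Proof. by rewrite lee_fin pos_ge0. Qed.

End positive_part.

Section increments.
Context {d} {T : measurableType d} {R : realType} (P : probability T R).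

Definition increment (X : R -> T -> R) (s u : R) (w : T) : R := X u w - X s w.

(** These sets only generate the past: the events known at time [s] are those of
    the sigma-algebra [<<s history X s >>]. *)
Definition history (X : R -> T -> R) (s : R) : set (set T) :=
  [set E | exists r A, [/\ 0 <= r <= s, measurable A & E = X r @^-1` A]].

(** What the argument needs to know about Brownian motion, in a form that [X] and
    [- X] share. The moment bound is of second order in [u - s], so over a grid of
    mesh [h] the errors that it controls add up to a quantity of order [h]. The
    mean is stated through positive and negative parts to stay within integrals
    of nonnegative functions. *)
Record centred_increments (X : R -> T -> R) (K : R) : Prop := {
  path_measurable : forall t, measurable_fun setT (X t) ;
  path_start : forall w, X 0 w = 0 ;
  path_continuous :
    forall w, {within `[0, +oo[%classic, continuous (fun t => X t w)} ;
  increment_independent : forall s u E D, 0 <= s -> s <= u ->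
    <<s history X s >> E -> measurable D ->
    P (E `&` increment X s u @^-1` D) =
      (P E * P (increment X s u @^-1` D))%E ;
  increment_mean : forall s u, 0 <= s -> s <= u ->
    (\int[P]_w (pos (increment X s u w))%:E =
     \int[P]_w (pos (- increment X s u w))%:E)%E ;
  increment_moment : forall s u, 0 <= s -> s <= u ->
    (\int[P]_w (increment X s u w ^+ 4)%:E <= (K * (u - s) ^+ 2)%:E)%E }.

Variables (X : R -> T -> R) (K : R) (X_ci : centred_increments X K).

Lemma history_measurable s E : <<s history X s >> E -> measurable E.
Proof.
move: E; apply: (smallest_sub (@sigma_algebra_measurable _ T)).
move=> _ [r [A [_ mA ->]]].
by rewrite -[X in measurable X]setTI; apply: (path_measurable X_ci).
Qed.

Lemma history_mono s u : s <= u -> <<s history X s >> `<=` <<s history X u >>.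
Proof.
move=> su; apply: sub_sigma_algebra2.
move=> E [r [A [/andP[r0 rs] mA ->]]].
by exists r, A; split => //; rewrite r0 (le_trans rs su).
Qed.

Lemma measurable_increment s u : measurable_fun setT (increment X s u).
Proof. by apply: measurable_funB; exact: (path_measurable X_ci). Qed.

(** The increment after [s] is independent of the whole past, so an integral of
    a function of both is computed by freezing the past. *)
Lemma integral_increment s u E (f : R * R -> \bar R) : 0 <= s -> s <= u ->
  <<s history X s >> E -> measurable_fun setT f -> (forall p, 0 <= f p)%E ->
  (\int[P]_(w in E) f (X s w, increment X s u w) =
   \int[P]_w' \int[P]_(w in E) f (X s w, increment X s u w'))%E.
Proof.
move=> s0 su FE mf f0.
pose T' := g_sigma_algebraType (history X s).
have mE' : measurable (E : set T') by exact: FE.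
have mXs : measurable_fun setT (X s : T' -> R).
  move=> _ A mA; rewrite setTI; apply: sub_sigma_algebra.
  by exists s, A; split => //; rewrite s0 lexx.
have mid : measurable_fun setT (id : T -> T').
  by move=> _ A mA; rewrite setTI; exact: history_measurable mA.
pose g (p : T' * R) := (f (X s p.1, p.2) * (\1_E p.1)%:E)%E.
have gE D h : (\int[P]_(w in D) f (X s w, h w) =
    \int[P]_w (f (X s w, h w) * (\1_D w)%:E))%E.
  by rewrite integral_mkcond; apply: eq_integral => w _; rewrite epatch_indic.
rewrite gE; under [RHS]eq_integral => w' _ do rewrite (gE _ (cst _)).
apply: (@integral_indep_pair _ _ _ _ T' _ _ P id (increment X s u) g) => //.
- exact: measurable_increment.
- by move=> A D mA mD; exact: (increment_independent X_ci).
- apply: emeasurable_funM.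
    apply: (measurableT_comp mf) => /=; apply: measurable_fun_pair => //=.
    by apply: (measurableT_comp mXs); exact: measurable_fst.
  have m1E : measurable_fun [set: T'] (\1_E : T' -> R) by exact: measurable_indic.
  by apply/measurable_EFinP; exact: (measurableT_comp m1E measurable_fst).
- by move=> p; rewrite mule_ge0// lee_fin.
Qed.

End increments.

(** * Moments and convexity along the path *)

Section increments_theory.
Context {d} {T : measurableType d} {R : realType} (P : probability T R).
Variables (X : R -> T -> R) (K : R) (X_ci : centred_increments P X K).

Local Notation mX := (path_measurable X_ci).
Local Notation mI := (measurable_increment X_ci).

Lemma norm_le_quartic (eta y : R) : 0 < eta -> `|y| <= eta + y ^+ 4 / eta ^+ 3.
Proof.
move=> eta0; have [ye|ey] := leP `|y| eta.
  rewrite (le_trans ye)// lerDl divr_ge0//; first exact: exprn_even_ge0.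
  by rewrite exprn_ge0// ltW.
apply: (@le_trans _ _ (y ^+ 4 / eta ^+ 3)); last by rewrite lerDr ltW.
rewrite ler_pdivlMr ?exprn_gt0//.
have -> : y ^+ 4 = `|y| * `|y| ^+ 3 by rewrite -exprS -normrX ger0_norm// exprn_even_ge0.
by apply: ler_wpM2l => //; rewrite ler_pXn2r// ?nnegrE ltW.
Qed.

Lemma increment_norm_moment s u (eta : R) : 0 <= s -> s <= u -> 0 < eta ->
  (\int[P]_w `|increment X s u w|%:E <=
   (eta + K * (u - s) ^+ 2 / eta ^+ 3)%:E)%E.
Proof.
move=> s0 su eta0.
have e30 : 0 <= (eta ^+ 3)^-1 by rewrite invr_ge0 exprn_ge0// ltW.
have mI4 : measurable_fun setT (fun w => (increment X s u w ^+ 4)%:E).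
  by apply/measurable_EFinP; apply: measurable_funX; exact: mI.
have I40 w : (0 <= (increment X s u w ^+ 4)%:E)%E.
  by rewrite lee_fin exprn_even_ge0.
apply: (@le_trans _ _ (\int[P]_w (eta%:E +
    (eta ^+ 3)^-1%:E * (increment X s u w ^+ 4)%:E))%E).
  apply: ge0_le_integral => //=.
  - by apply/measurable_EFinP; apply: measurableT_comp => //; exact: mI.
  - by apply: emeasurable_funD => //; exact: measurable_funeM.
  - move=> w _; rewrite -EFinM -EFinD lee_fin [_^-1 * _]mulrC.
    exact: norm_le_quartic.
rewrite ge0_integralD//; last 3 first.
- by move=> w _; rewrite lee_fin ltW.
- by move=> w _; rewrite mule_ge0.
- exact: measurable_funeM.
rewrite integral_cst//= probability_setT mule1 EFinD leeD2l//.
rewrite ge0_integralZl//.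
rewrite [leRHS]EFinM [leRHS]muleC lee_wpmul2l//.
exact: (increment_moment X_ci).
Qed.

Lemma increment_norm_lty s u : 0 <= s -> s <= u ->
  (\int[P]_w `|increment X s u w|%:E < +oo)%E.
Proof.
move=> s0 su; apply: le_lt_trans (increment_norm_moment s0 su ltr01) _.
exact: ltry.
Qed.

Lemma integral_le_increment_lty s u E (f : T -> R) (k : R) : 0 <= s -> s <= u ->
  measurable E -> measurable_fun E f -> (forall w, 0 <= f w) ->
  (forall w, f w <= `|increment X s u w| + k) ->
  (\int[P]_(w in E) (f w)%:E < +oo)%E.
Proof.
move=> s0 su mE mf f0 fle.
have mnI : measurable_fun setT (fun w => `|increment X s u w|%:E).
  by apply/measurable_EFinP; apply: measurableT_comp => //; exact: mI.
apply: (@le_lt_trans _ _ (\int[P]_(w in E) (`|increment X s u w|%:E + `|k|%:E))%E).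
  apply: ge0_le_integral => //.
  - by move=> w _; rewrite lee_fin.
  - exact/measurable_EFinP.
  - by apply: emeasurable_funD => //; exact: measurable_funTS.
  - move=> w _; rewrite -EFinD lee_fin; apply: (le_trans (fle w)).
    by rewrite lerD2l ler_norm.
rewrite ge0_integralD//; last exact: measurable_funTS.
rewrite integral_cst//; apply: lte_add_pinfty.
  apply: le_lt_trans (increment_norm_lty s0 su).
  by apply: ge0_subset_integral => //.
rewrite lte_mul_pinfty//.
by rewrite (le_lt_trans (probability_le1 P mE))// ltry.
Qed.

Lemma path_increment t w : X t w = increment X 0 t w.
Proof. by rewrite /increment (path_start X_ci) subr0. Qed.

Lemma measurable_pos_path (E : set T) t x :
  measurable_fun E (fun w => (pos (X t w - x))%:E).
Proof.
apply: measurable_funTS; apply: measurable_pos.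
by apply: measurable_funB => //; exact: mX.
Qed.

Lemma measurable_pos_increment (E : set T) s u :
  measurable_fun E (fun w => (pos (increment X s u w))%:E).
Proof. by apply: measurable_funTS; apply: measurable_pos; exact: mI. Qed.

Lemma measurable_pos_incrementN (E : set T) s u :
  measurable_fun E (fun w => (pos (- increment X s u w))%:E).
Proof.
apply: measurable_funTS; apply: measurable_pos.
by apply: measurableT_comp => //; exact: mI.
Qed.

Lemma integral_pos_path_lty E t x : 0 <= t -> measurable E ->
  (\int[P]_(w in E) (pos (X t w - x))%:E < +oo)%E.
Proof.
move=> t0 mE; apply: (@integral_le_increment_lty 0 t _ _ `|x|) => //.
- by apply/measurable_EFinP; exact: measurable_pos_path.
- by move=> w; exact: pos_ge0.
- move=> w; rewrite -path_increment ge_max addr_ge0// andbT.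
  by rewrite (le_trans (ler_norm _))// ler_normB.
Qed.

Lemma integral_pos_increment_lty E s u : 0 <= s -> s <= u -> measurable E ->
  (\int[P]_(w in E) (pos (increment X s u w))%:E < +oo)%E /\
  (\int[P]_(w in E) (pos (- increment X s u w))%:E < +oo)%E.
Proof.
move=> s0 su mE.
split; apply: (@integral_le_increment_lty s u _ _ 0) => //.
- by apply/measurable_EFinP; exact: measurable_pos_increment.
- by move=> w; exact: pos_ge0.
- by move=> w; rewrite addr0 ge_max normr_ge0 ler_norm.
- by apply/measurable_EFinP; exact: measurable_pos_incrementN.
- by move=> w; exact: pos_ge0.
- by move=> w; rewrite addr0 ge_max normr_ge0 andbT -normrN ler_norm.
Qed.

Lemma increment_mean_on s u E : 0 <= s -> s <= u -> <<s history X s >> E ->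
  (\int[P]_(w in E) (pos (increment X s u w))%:E =
   \int[P]_(w in E) (pos (- increment X s u w))%:E)%E.
Proof.
move=> s0 su FE.
have mE := history_measurable X_ci FE.
have mp : measurable_fun setT (fun p : R * R => (pos p.2)%:E).
  exact: measurable_pos.
have mn : measurable_fun setT (fun p : R * R => (pos (- p.2))%:E).
  by apply: measurable_pos; exact: measurableT_comp.
rewrite (integral_increment X_ci s0 su FE mp) => [|p]; last exact: epos_ge0.
rewrite (integral_increment X_ci s0 su FE mn) => [|p]; last exact: epos_ge0.
have cstE (r : R) : (\int[P]_(w in E) r%:E = r%:E * P E)%E by rewrite integral_cst.
under eq_integral => w _ do rewrite /= cstE.
under [RHS]eq_integral => w _ do rewrite /= cstE.
rewrite !ge0_integralZr//; first by rewrite (increment_mean X_ci).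
all: try by move=> w _; exact: epos_ge0.
- exact: measurable_pos_incrementN.
- exact: measurable_pos_increment.
Qed.

(** Jensen's inequality for the convex function [pos (_ - x)]. On the event [G] that
    [X s] exceeds [x] the increment enters linearly, and it has mean zero there;
    outside [G] the left-hand side vanishes. *)
Lemma pos_path_submartingale s u E x : 0 <= s -> s <= u -> <<s history X s >> E ->
  (\int[P]_(w in E) (pos (X s w - x))%:E <=
   \int[P]_(w in E) (pos (X u w - x))%:E)%E.
Proof.
move=> s0 su FE.
pose G := E `&` X s @^-1` `]x, +oo[.
have FG : <<s history X s >> G.
  apply: (@measurableI _ (g_sigma_algebraType (history X s))) => //.
  by apply: sub_sigma_algebra; exists s, `]x, +oo[%classic; split => //; rewrite s0 lexx.
have mE := history_measurable X_ci FE.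
have mG := history_measurable X_ci FG.
have GE : G `<=` E by exact: subIsetl.
rewrite (ge0_integral_setD _ mE mG)//; last 2 first.
- exact: measurable_pos_path.
- by move=> w _; exact: epos_ge0.
rewrite [leRHS](ge0_integral_setD _ mE mG)//; last 2 first.
- exact: measurable_pos_path.
- by move=> w _; exact: epos_ge0.
apply: leeD; last first.
  rewrite [leLHS]integral0_eq => [|w [Ew]]; first by apply: integral_ge0 => w _; exact: epos_ge0.
  move=> /not_andP[//|/=]; rewrite in_itv/= andbT => /negP; rewrite -leNgt => Xx.
  by congr EFin; apply/max_idPr; rewrite subr_le0.
have [fp fn] := integral_pos_increment_lty s0 su mG.
rewrite -(@leeD2rE _ (\int[P]_(w in G) (pos (increment X s u w))%:E)%E); last first.
  by rewrite ge0_fin_numE// integral_ge0// => w _; exact: epos_ge0.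
rewrite [in leRHS]increment_mean_on// -!ge0_integralD//;
  try (by move=> w _; exact: epos_ge0);
  try exact: measurable_pos_path; try exact: measurable_pos_increment;
  try exact: measurable_pos_incrementN.
apply: ge0_le_integral => //.
- by move=> w _; rewrite adde_ge0// epos_ge0.
- by apply: emeasurable_funD; [exact: measurable_pos_path|exact: measurable_pos_increment].
- by apply: emeasurable_funD; [exact: measurable_pos_path|exact: measurable_pos_incrementN].
- move=> w [_ /=]; rewrite in_itv/= andbT => xX; rewrite -!EFinD lee_fin.
  rewrite /increment.
  have -> : pos (X s w - x) = X s w - x by apply/max_idPl; rewrite subr_ge0 ltW.
  rewrite -!/(Num.max _ _) /Num.max; do 3 case: ifP => ?; lra.
Qed.

Lemma integral_pos_path_increment s u E x : 0 <= s -> s <= u ->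
  <<s history X s >> E ->
  (\int[P]_(w in E) (pos (X u w - x))%:E =
   \int[P]_w' \int[P]_(w in E) (pos (X s w + increment X s u w' - x))%:E)%E.
Proof.
move=> s0 su FE.
have mf : measurable_fun setT (fun p : R * R => (pos (p.1 + p.2 - x))%:E).
  apply: measurable_pos; apply: measurable_funB => //.
  exact: measurable_funD.
have /= <- := integral_increment X_ci s0 su FE mf; last by move=> p; exact: epos_ge0.
by apply: eq_integral => w _; rewrite /increment (addrC (X s w)) subrK.
Qed.

End increments_theory.

(** * Crossing a monotone boundary *)

Section boundary_crossing.
Context {R : realType}.
Implicit Types (f : R -> R) (b : R -> \bar R).

Lemma lte_gap (x : R) (y : \bar R) :
  (x%:E < y)%E -> exists2 e : R, 0 < e & ((x + e)%:E < y)%E.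
Proof.
case: y => [y| _|]; last by rewrite ltNge leNye.
- by rewrite lte_fin => xy; exists ((y - x) / 2); [|rewrite lte_fin]; lra.
- by exists 1; rewrite ?ltr01 ?ltry.
Qed.

(** Paths are continuous on the half-line only, so at [0] only times [r' >= 0] may
    be compared. *)
Definition continuous_on_nneg f := forall r e : R, 0 <= r -> 0 < e ->
  exists2 dl, 0 < dl & forall r', 0 <= r' -> `|r' - r| < dl -> `|f r' - f r| < e.

Lemma within_continuous_on_nneg f :
  {within `[0, +oo[%classic, continuous f} -> continuous_on_nneg f.
Proof.
move=> /subspace_continuousP f_cont r e r0 e0.
have /f_cont : `[0, +oo[%classic r by rewrite /= in_itv/= andbT.
move=> /cvgrPdist_lt/(_ e e0).
rewrite near_withinE => /nbhs_ballP[dl /= dl0 dlf].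
exists dl => // r' r'0 rr'; rewrite distrC; apply: dlf.
  by rewrite /ball/= distrC.
by rewrite /= in_itv/= andbT.
Qed.

(** Lower semicontinuity of [b]: to the left of [r] by left continuity, to the
    right by monotonicity. *)
Lemma near_below_boundary f b r : continuous_on_nneg f -> increasing b ->
  left_continuous b -> 0 < r -> ((f r)%:E < b r)%E ->
  \forall r' \near r & n \near \oo, ((f r' + n.+1%:R^-1)%:E <= b r')%E.
Proof.
move=> f_cont b_inc b_lc r0 /lte_gap[e e0 feb].
have [dl dl0 fdl] := f_cont _ (e / 2) (ltW r0) (divr_gt0 e0 (ltr0n _ 2)).
have b_near : \forall r' \near r, ((f r + e)%:E < b r')%E.
  have : \forall s \near r^'-, ((f r + e)%:E < b s)%E.
    apply: (b_lc r r0 [set y | ((f r + e)%:E < y)%E]); apply: open_nbhs_nbhs; split => //.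
    exact: open_ereal_gt_ereal.
  rewrite near_withinE; apply: filterS => s sb.
  have [/sb//|rs] := ltP s r.
  exact: (lt_le_trans feb (b_inc _ _ r0 rs)).
have f_near : \forall r' \near r, `|f r' - f r| < e / 2.
  have : \forall r' \near r, 0 < r' by exact: lt_nbhsr.
  apply: filterS2 (nbhsx_ballx r dl dl0) => r' rr' r'0.
  by apply: fdl (ltW r'0) _; rewrite distrC.
have n_near : \forall n \near \oo, n.+1%:R^-1 < e / 2.
  have e20 : 0 < e / 2 by rewrite divr_gt0.
  exact: (near_infty_natSinv_lt (PosNum e20)).
have b_f_near : \forall r' \near r, ((f r + e)%:E < b r')%E /\ `|f r' - f r| < e / 2.
  by apply: filterS2 b_near f_near.
apply: filterS2 (filter_prod1 b_f_near) (filter_prod2 n_near).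
move=> [r' n] /= [feb' ff] ne; apply: le_trans (ltW feb'); rewrite lee_fin.
move: ff ne; rewrite ltr_norml; set k := n.+1%:R^-1 => /andP[? ?] ?.
lra.
Qed.

(** Compactness of [[p, s]], applied to the preceding neighbourhoods. *)
Lemma uniformly_below_boundary f b p s : continuous_on_nneg f -> increasing b ->
  left_continuous b -> 0 < p -> (forall r, p <= r <= s -> ((f r)%:E < b r)%E) ->
  exists n : nat, forall r, p <= r <= s -> ((f r + n.+1%:R^-1)%:E <= b r)%E.
Proof.
move=> f_cont b_inc b_lc p0 fb.
have /compact_near_coveringP cov := @segment_compact R p s.
have : \forall n \near \oo,
    `[p, s] `<=` [set r | ((f r + n.+1%:R^-1)%:E <= b r)%E].
  apply: cov => r /=; rewrite in_itv/= => prs.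
  apply: near_below_boundary => //; last exact: fb.
  by case/andP: prs => pr _; exact: lt_le_trans p0 pr.
move=> [n _ /(_ n (leqnn n)) fbn]; exists n => r prs.
by apply: fbn; rewrite /= in_itv.
Qed.

(** A gap at the rational times suffices: at a rational just before [u] the
    function is close to [f u], and an increasing boundary is at most [b u]. *)
Lemma below_boundary_of_rat f b p u e : continuous_on_nneg f -> increasing b ->
  0 <= p -> p < u -> 0 < e ->
  (forall q : rat, p < ratr q <= u -> ((f (ratr q) + e)%:E <= b (ratr q))%E) ->
  ((f u)%:E < b u)%E.
Proof.
move=> f_cont b_inc p0 pu e0 fb.
have u0 : 0 <= u by exact: le_trans p0 (ltW pu).
have [dl dl0 fdl] := f_cont _ e u0 e0.
have /rat_in_itvoo[q] : Num.max p (u - dl) < u by rewrite gt_max pu gtrBl.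
rewrite in_itv/= gt_max => /andP[/andP[pq dlq] qu].
have q0 : 0 < ratr q :> R by exact: le_lt_trans p0 pq.
have := fb q; rewrite pq (ltW qu) => /(_ isT) fqb.
apply: lt_le_trans (b_inc _ _ q0 (ltW qu)); apply: lt_le_trans fqb.
rewrite lte_fin; have : `|f (ratr q) - f u| < e.
  by apply: fdl; [exact: ltW|rewrite ltr_norml; lra].
by rewrite ltr_norml => /andP[? ?]; lra.
Qed.

(** Staying below the boundary is a condition at uncountably many times. By the two
    lemmas above it amounts to a gap [1 / n.+1] at all rational times of [[p, s]],
    for some [n] that depends on the rational [p > 0]; there need be no uniform gap
    near time [0]. *)
Lemma measurable_below_boundary (T : pointedType) (G : set (set T)) (Z : R -> T -> R) b s :
  increasing b -> left_continuous b -> (forall w, continuous_on_nneg (Z ^~ w)) ->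
  (forall q e, 0 < q <= s -> <<s G >> [set w | ((Z q w + e)%:E <= b q)%E]) ->
  <<s G >> [set w | forall r, 0 < r <= s -> ((Z r w)%:E < b r)%E].
Proof.
move=> b_inc b_lc Z_cont GZ.
pose T' := g_sigma_algebraType G.
pose gap (p : rat) (n : nat) (q : rat) : set T' :=
  [set w | 0 < p -> p < q -> ratr q <= s ->
    ((Z (ratr q) w + n.+1%:R^-1)%:E <= b (ratr q))%E].
have -> : [set w | forall r, 0 < r <= s -> ((Z r w)%:E < b r)%E] =
    ~` \bigcup_p ~` \bigcup_n ~` \bigcup_q ~` gap p n q.
  apply/seteqP; split => w /= Zb.
    move=> [p _]; apply; have [p0|p0] := ltP 0 p; last first.
      by exists 0%N => // -[q _]; apply => p0'; move: (lt_le_trans p0' p0); rewrite ltxx.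
    have [|r prs|n Zbn] := @uniformly_below_boundary _ b (ratr p) s (Z_cont w) b_inc b_lc.
    - by rewrite ltr0q.
    - by apply: Zb; case/andP: prs => pr ->; rewrite (lt_le_trans _ pr)// ltr0q.
    exists n => // -[q _]; apply => _ pq qs; apply: Zbn.
    by rewrite qs ler_rat ltW.
  move=> r /andP[r0 rs].
  have /rat_in_itvoo[p] := r0; rewrite in_itv/= ltr0q => /andP[p0 pr].
  apply: contrapT => Zr; apply: Zb; exists p => //= -[n _ Zn]; apply: Zr.
  apply: (@below_boundary_of_rat (Z ^~ w) b (ratr p) r n.+1%:R^-1) => //.
  - by rewrite ler0q ltW.
  - move=> q /andP[pq qr]; apply: contrapT => Zq; apply: Zn; exists q => //=.
    by move=> H; apply: Zq; apply: H => //; [rewrite -(ltr_rat R)|exact: le_trans rs].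
suff mgap p n q : measurable (gap p n q).
  apply: (@measurableC _ T'); apply: bigcupT_measurable_rat => p.
  apply: (@measurableC _ T'); apply: bigcupT_measurable => n.
  apply: (@measurableC _ T'); apply: bigcupT_measurable_rat => q.
  exact: (@measurableC _ T').
have [H|H] := pselect [/\ 0 < p, p < q & ratr q <= s]; last first.
  rewrite (_ : gap p n q = setT); first exact: (@measurableT _ T').
  by apply/seteqP; split => // w _ p0 pq qs; exfalso; apply: H.
have [p0 pq qs] := H.
rewrite (_ : gap p n q =
  [set w | ((Z (ratr q) w + n.+1%:R^-1)%:E <= b (ratr q))%E]).
  by apply: GZ; rewrite qs ltr0q (lt_trans p0).
by apply/seteqP; split => w /=; [apply|move=> + _ _ _].
Qed.

End boundary_crossing.

(** * The hitting time of receding boundaries *)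

(** This covers all the cases of a pair of boundary functions, because a boundary
    that is constantly infinite is both increasing and decreasing. *)
Record expanding_boundaries {R : realType} (b c : R -> \bar R) : Prop := {
  upper_increasing : increasing b ;
  upper_left_continuous : left_continuous b ;
  lower_decreasing : decreasing c ;
  lower_left_continuous : left_continuous c }.

Lemma expanding_boundariesN {R : realType} (b c : R -> \bar R) :
  expanding_boundaries b c ->
  expanding_boundaries (fun t => (- c t)%E) (fun t => (- b t)%E).
Proof.
case=> b_inc b_lc c_dec c_lc; split.
- by move=> s t s0 st; rewrite leeN2; exact: c_dec.
- by move=> t t0; apply: cvgeN; exact: c_lc.
- by move=> s t s0 st; rewrite leeN2; exact: b_inc.
- by move=> t t0; apply: cvgeN; exact: b_lc.
Qed.

(** Only times [r > 0] count, so [no_hit X b c 0] is the whole space however the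
    boundaries behave near [0]. *)
Definition no_hit {R : realType} {T : Type} (X : R -> T -> R) (b c : R -> \bar R)
    (s : R) : set T :=
  [set w | forall r, 0 < r <= s -> (c r < (X r w)%:E < b r)%E].

Section hitting.
Context {d} {T : measurableType d} {R : realType} (P : probability T R).
Variables (X : R -> T -> R) (K : R) (X_ci : centred_increments P X K).
Variables (b c : R -> \bar R) (bc : expanding_boundaries b c).

Local Notation A := (no_hit X b c).
Local Notation tau := (hitting_time X b c).

(** Where the boundaries are never hit this is [X 0], since [fine +oo] is [0]. *)
Definition hitting_value (w : T) : R := X (fine (tau w)) w.
Local Notation Y := hitting_value.

Lemma path_continuous_on_nneg w : continuous_on_nneg (X ^~ w).
Proof. by apply: within_continuous_on_nneg; exact: (path_continuous X_ci). Qed.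

Lemma no_hit_mono s u : s <= u -> A u `<=` A s.
Proof.
move=> su w Au r /andP[r0 rs]; apply: Au.
by rewrite r0 (le_trans rs).
Qed.

Lemma no_hit0 : A 0 = setT.
Proof.
apply/seteqP; split => // w _ r /andP[r0 r0'].
by move: (lt_le_trans r0 r0'); rewrite ltxx.
Qed.

Lemma no_hit_history s : 0 <= s -> <<s history X s >> (A s).
Proof.
move=> s0; have [b_inc b_lc Nc_inc Nc_lc] := bc.
have {Nc_inc Nc_lc} [Nc_inc Nc_lc _ _] := expanding_boundariesN bc.
have X_hist q B : 0 < q <= s -> measurable B -> <<s history X s >> (X q @^-1` B).
  move=> /andP[q0 qs] mB; apply: sub_sigma_algebra; exists q, B; split => //.
  by rewrite (ltW q0).
have mf e (a : \bar R) (f : R -> R) : measurable_fun setT f ->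
    measurable [set x | ((f x + e)%:E <= a)%E].
  move=> mf; rewrite -[X in measurable X]setTI.
  apply: emeasurable_fun_le => //; apply/measurable_EFinP.
  exact: measurable_funD.
have Hb : <<s history X s >> [set w | forall r, 0 < r <= s -> ((X r w)%:E < b r)%E].
  apply: measurable_below_boundary => //; first exact: path_continuous_on_nneg.
  by move=> q e qs; apply: X_hist (mf e (b q) id _).
have Hc : <<s history X s >> [set w | forall r, 0 < r <= s -> ((- X r w)%:E < - c r)%E].
  apply: (@measurable_below_boundary _ _ _ (fun r w => - X r w)) => //.
  - move=> w r e r0 e0; have [dl dl0 fdl] := path_continuous_on_nneg w r0 e0.
    by exists dl => // r' r'0 rr'; rewrite -opprD normrN; exact: fdl.
  - by move=> q e qs; apply: X_hist (mf e (- c q)%E -%R _).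
have -> : A s = [set w | forall r, 0 < r <= s -> ((X r w)%:E < b r)%E] `&`
    [set w | forall r, 0 < r <= s -> ((- X r w)%:E < - c r)%E].
  apply/seteqP; split => [w Aw|w [/= wb wc] r rs].
    by split => r /Aw /andP[? ?] //; rewrite EFinN lteN2.
  by rewrite wb// andbT -lteN2 -EFinN wc.
exact: (@measurableI _ (g_sigma_algebraType (history X s))).
Qed.

Lemma measurable_no_hit s : 0 <= s -> measurable (A s).
Proof. by move=> s0; exact: (history_measurable X_ci (no_hit_history s0)). Qed.

Lemma hitting_time_ge0 w : (0 <= tau w)%E.
Proof. by apply: le_ereal_inf_tmp => _ [t [t0 _] <-]; rewrite lee_fin ltW. Qed.

Lemma no_hit_le_hitting_time s w : A s w -> (s%:E <= tau w)%E.
Proof.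
move=> As; apply: le_ereal_inf_tmp => _ [t [t0 ht] <-]; rewrite lee_fin leNgt.
apply/negP => ts; have /As/andP[ct bt] : 0 < t <= s by rewrite t0 ltW.
by move: ht => [|]; rewrite leNgt ?ct ?bt.
Qed.

Lemma hit_hitting_time_le s w : ~ A s w -> (tau w <= s%:E)%E.
Proof.
move=> /existsNP[r /not_implyP[/andP[r0 rs]]] /negP; rewrite negb_and -!leNgt => h.
apply: (@le_trans _ _ r%:E); last by rewrite lee_fin.
by apply: ereal_inf_lbound; exists r => //; split => //; move/orP: h => [|]; [right|left].
Qed.

(** The boundaries recede from each other, so whatever they look like at the
    hitting time, the path is by then outside the interval that they bounded
    earlier. *)
Lemma hitting_value_outside s w : 0 < s -> A s w -> (tau w < +oo)%E ->
  (b s <= (Y w)%:E)%E \/ ((Y w)%:E <= c s)%E.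
Proof.
move=> s0 As tauy; apply: contrapT => /not_orP[/negP + /negP]; rewrite -!ltNge => Yb cY.
have [b_inc _ c_dec _] := bc.
have tau_fin : tau w \is a fin_num by rewrite ge0_fin_numE// hitting_time_ge0.
have t0 : 0 <= fine (tau w) by rewrite fine_ge0// hitting_time_ge0.
have [e e0 Yeb] := lte_gap Yb.
have [|e' e'0 Yec] := @lte_gap _ (- Y w) (- c s)%E; first by rewrite EFinN lteN2.
have ee'0 : 0 < Num.min e e' by rewrite lt_min e0.
have [dl dl0 Xdl] := path_continuous_on_nneg w t0 ee'0.
have [|_ [t [r0 ht] <-]] := @ereal_inf_lt _ [set t%:E | t in
    [set t : R | 0 < t /\ ((b t <= (X t w)%:E)%E \/ ((X t w)%:E <= c t)%E)]]
    (fine (tau w) + dl)%:E.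
  by rewrite EFinD -/(tau w) fineK// lteDl// lte_fin.
rewrite lte_fin => tdl.
have tau_t : fine (tau w) <= t.
  rewrite -lee_fin fineK//; apply: ereal_inf_lbound; exists t => //.
have st : s <= t by rewrite -lee_fin (le_trans (no_hit_le_hitting_time As))// -[tau w]fineK.
have : `|X t w - Y w| < Num.min e e'.
  by apply: Xdl; [exact: ltW|rewrite ger0_norm ?subr_ge0// ltrBlDl].
rewrite lt_min !ltr_norml => /andP[/andP[_ Xe] /andP[Xe' _]].
case: ht; apply/negP; rewrite -ltNge.
- apply: lt_le_trans (b_inc _ _ s0 st); apply: le_lt_trans Yeb.
  by rewrite lee_fin; lra.
- apply: le_lt_trans (c_dec _ _ s0 st) _; rewrite -lteN2; apply: le_lt_trans Yec.
  by rewrite -EFinN lee_fin; lra.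
Qed.

End hitting.

(** * Rounding the hitting time up to a grid *)

Section stopping.
Context {d} {T : measurableType d} {R : realType} (P : probability T R).
Variables (X : R -> T -> R) (K : R) (X_ci : centred_increments P X K).
Variables (b c : R -> \bar R) (bc : expanding_boundaries b c).

Local Notation A := (no_hit X b c).
Local Notation tau := (hitting_time X b c).
Local Notation Y := (hitting_value X b c).

Lemma integral_indicE (D : set T) (f : T -> R) :
  (\int[P]_(w in D) (f w)%:E = \int[P]_w (\1_D w * f w)%:E)%E.
Proof.
rewrite integral_mkcond; apply: eq_integral => w _.
by rewrite epatch_indic /= -EFinM mulrC.
Qed.

Lemma indic_no_hitD s u : s <= u ->
  \1_(A s `\` A u) = (fun w => \1_(A s) w - \1_(A u) w) :> (T -> R).
Proof.
move=> su; apply/funext => w; rewrite !indicE in_setD.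
have [Au|Au] := boolP (w \in A u); last by rewrite andbT subr0.
by rewrite andbF (_ : w \in A s) ?subrr//; apply/mem_set/(no_hit_mono su)/set_mem.
Qed.

Definition grid (s u : R) (m j : nat) : R := s + (u - s) * (j%:R / m.+1%:R).

Lemma grid0 s u m : grid s u m 0 = s.
Proof. by rewrite /grid mul0r mulr0 addr0. Qed.

Lemma grid_max s u m : grid s u m m.+1 = u.
Proof. by rewrite /grid divff// mulr1 addrC subrK. Qed.

Lemma gridS s u m j : grid s u m j.+1 = grid s u m j + (u - s) / m.+1%:R.
Proof. by rewrite /grid -natr1 [(_ + 1) / _]mulrDl mul1r mulrDr addrA. Qed.

Lemma grid_mono s u m j k : s <= u -> (j <= k)%N -> grid s u m j <= grid s u m k.
Proof.
move=> su jk; rewrite lerD2l ler_wpM2l ?subr_ge0//.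
by rewrite ler_wpM2r// ler_nat.
Qed.

Lemma grid_ge0 s u m j : 0 <= s -> s <= u -> 0 <= grid s u m j.
Proof.
by move=> s0 su; rewrite addr_ge0// mulr_ge0 ?subr_ge0// divr_ge0.
Qed.

(** A hit that occurs between two grid times is rounded up to the later one, and
    [phi] is evaluated there. Grid times are known in advance, so the increments
    after them are independent of the event that carries them. *)
Definition grid_approx (phi : R -> R) s u m (w : T) : R :=
  \sum_(j < m.+1) \1_(A (grid s u m j) `\` A (grid s u m j.+1)) w *
    phi (X (grid s u m j.+1) w).

Lemma grid_weight_sum s u m w : s <= u ->
  \sum_(j < m.+1) \1_(A (grid s u m j) `\` A (grid s u m j.+1)) w =
  \1_(A s `\` A u) w :> R.
Proof.
move=> su; rewrite indic_no_hitD//.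
under eq_bigr do rewrite indic_no_hitD ?grid_mono//.
pose f j : R := - \1_(A (grid s u m j)) w.
have := @telescope_sumr_eq R 0 m.+1 f
  (fun j => \1_(A (grid s u m j)) w - \1_(A (grid s u m j.+1)) w).
rewrite big_mkord /f => ->//.
- by rewrite grid_max grid0 opprK addrC.
- by move=> k _; rewrite opprK addrC.
Qed.

(** Rounding moves the hitting time by at most the mesh, and the path is
    continuous. *)
Lemma grid_approx_cvg (phi : R -> R) s u w : continuous phi -> 0 <= s -> s <= u ->
  grid_approx phi s u ^~ w @ \oo --> \1_(A s `\` A u) w * phi (Y w).
Proof.
move=> phi_cont s0 su; apply/cvgrPdist_le => e e0.
have t0 : 0 <= fine (tau w) by rewrite fine_ge0// hitting_time_ge0.
have /cvgrPdist_le/(_ e e0)/nbhs_ballP[e' /= e'0 phi_e'] := phi_cont (Y w).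
have [dl dl0 Xdl] := path_continuous_on_nneg X_ci w t0 e'0.
have dlu : 0 < dl / (u - s + 1) by rewrite divr_gt0// ltr_wpDl// subr_ge0.
near=> m.
have mdl : (u - s) / m.+1%:R < dl.
  have : m.+1%:R^-1 < dl / (u - s + 1).
    by near: m; exact: (near_infty_natSinv_lt (PosNum dlu)).
  rewrite ltr_pdivlMr ?ltr_wpDl ?subr_ge0// => /(le_lt_trans _); apply.
  by rewrite mulrC ler_wpM2l ?invr_ge0// lerDl.
rewrite -(grid_weight_sum m w su) mulr_suml -sumrB.
apply: (le_trans (ler_norm_sum _ _ _)).
apply: (@le_trans _ _ (\sum_(j < m.+1)
    \1_(A (grid s u m j) `\` A (grid s u m j.+1)) w * e)).
  apply: ler_sum => j _; rewrite -mulrBr normrM ger0_norm//.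
  rewrite indicE; have [|_] := boolP (_ \in _); last by rewrite !mul0r.
  rewrite inE !mul1r => -[Aj /(hit_hitting_time_le)].
  move: (no_hit_le_hitting_time Aj) => jt tj.
  have tau_fin : tau w \is a fin_num.
    by rewrite ge0_fin_numE ?hitting_time_ge0// (le_lt_trans tj)// ltry.
  rewrite -(fineK tau_fin) lee_fin in jt; rewrite -(fineK tau_fin) lee_fin in tj.
  apply: phi_e'; rewrite /ball/= distrC; apply: Xdl.
    exact: (le_trans t0).
  rewrite ger0_norm ?subr_ge0// ltrBlDr gridS addrC.
  exact: ltr_leD.
rewrite -mulr_suml grid_weight_sum// indicE.
by case: (_ \in _); rewrite ?mul1r// mul0r ltW.
Unshelve. all: by end_near. Qed.

Lemma measurable_no_hitD s u : 0 <= s -> s <= u -> measurable (A s `\` A u).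
Proof.
move=> s0 su; apply: measurableD; apply: (measurable_no_hit X_ci bc) => //.
exact: le_trans su.
Qed.

Lemma measurable_grid_approx (phi : R -> R) s u m : continuous phi -> 0 <= s -> s <= u ->
  measurable_fun setT (grid_approx phi s u m).
Proof.
move=> phi_cont s0 su; apply: measurable_sum => j; apply: measurable_funM.
  by apply: measurable_indic; apply: measurable_no_hitD; rewrite ?grid_ge0 ?grid_mono.
apply: (measurableT_comp (continuous_measurable_fun phi_cont)).
exact: (path_measurable X_ci).
Qed.

Lemma measurable_indic_hitting_value (phi : R -> R) s u : continuous phi -> 0 <= s -> s <= u ->
  measurable_fun setT (fun w => \1_(A s `\` A u) w * phi (Y w)).
Proof.
move=> phi_cont s0 su; apply: (@measurable_fun_cvg _ _ _ _ (grid_approx phi s u)).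
- by move=> m; exact: measurable_grid_approx.
- by move=> w _; exact: grid_approx_cvg.
Qed.

(** The indicators of a hit by time [n] increase to that of a hit, and where there is
    no hit [Y] is [X 0 = 0]. *)
Lemma measurable_hitting_value : measurable_fun setT Y.
Proof.
apply: (@measurable_fun_cvg _ _ _ _ (fun n w => \1_(A 0 `\` A n%:R) w * Y w)).
  move=> n; apply: (@measurable_indic_hitting_value id) => //.
  by move=> x; exact: cvg_id.
move=> w _; have := hitting_time_ge0 X b c w.
case E : (tau w) => [t||]//= t0; last first.
  rewrite /hitting_value E /= (path_start X_ci).
  by under eq_fun do rewrite mulr0; exact: cvg_cst.
apply: cvg_near_cst; near=> n.
rewrite indicE mem_set ?mul1r//; split; first by rewrite no_hit0.
move=> /no_hit_le_hitting_time; rewrite E lee_fin leNgt => /negP; apply.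
by near: n; exact: nbhs_infty_gtr.
Unshelve. all: by end_near. Qed.

Lemma continuous_pos_sub (x : R) : continuous (fun y : R => pos (y - x)).
Proof.
move=> y; apply: (@continuous_max R _ (fun z => z - x) (fun=> 0)).
  by apply: (@cvgB _ R^o); [exact: cvg_id|exact: cvg_cst].
exact: cst_continuous.
Qed.

(** Optional stopping for the submartingale [pos (X _ - x)]: it holds for the hitting
    time rounded up to a grid, one grid interval at a time, and passes to the limit
    by Fatou's lemma. *)
Lemma hitting_value_submartingale s u x : 0 <= s -> s <= u ->
  (\int[P]_(w in A s `\` A u) (pos (Y w - x))%:E <=
   \int[P]_(w in A s `\` A u) (pos (X u w - x))%:E)%E.
Proof.
move=> s0 su; have phi_cont := @continuous_pos_sub x.
pose phi y := pos (y - x).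
have phi0 y : 0 <= phi y by exact: pos_ge0.
have mphi r : measurable_fun setT (fun w => phi (X r w)).
  apply: (measurableT_comp (continuous_measurable_fun phi_cont)).
  exact: (path_measurable X_ci).
rewrite integral_indicE; apply: (@le_integral_cvg _ _ _ P
  (fun m w => (grid_approx phi s u m w)%:E)) => [m|m w|w|m].
- by apply/measurable_EFinP; exact: measurable_grid_approx.
- by rewrite lee_fin sumr_ge0// => j _; rewrite mulr_ge0.
- by apply: cvg_EFin; [exact: nearW|exact: grid_approx_cvg].
pose E j := A (grid s u m j) `\` A (grid s u m j.+1).
have mE j : measurable (E j) by apply: measurable_no_hitD; rewrite ?grid_ge0 ?grid_mono.
have mEphi j r : measurable_fun setT (fun w => (\1_(E j) w * phi (X r w))%:E).
  by apply/measurable_EFinP; apply: measurable_funM => //; exact: measurable_indic.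
have Ephi0 j r w : (0 <= (\1_(E j) w * phi (X r w))%:E)%E by rewrite lee_fin mulr_ge0.
have sumE (r : nat -> R) :
    (\int[P]_w (\sum_(j < m.+1) \1_(E j) w * phi (X (r j) w))%:E =
     \sum_(j < m.+1) \int[P]_(w in E j) (phi (X (r j) w))%:E)%E.
  under eq_integral do rewrite -sumEFin.
  rewrite (@ge0_integral_sum _ _ _ P _ measurableT _
    (fun (j : 'I_m.+1) w => (\1_(E j) w * phi (X (r j) w))%:E))//.
  by apply: eq_bigr => j _; exact/esym/integral_indicE.
rewrite (sumE (fun j => grid s u m j.+1)).
apply: (@le_trans _ _ (\sum_(j < m.+1) \int[P]_(w in E j) (phi (X u w))%:E)%E).
  apply: lee_sum => j _.
  apply: (pos_path_submartingale X_ci); first exact: grid_ge0.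
    by rewrite -[leRHS](grid_max s u m) grid_mono.
  apply: (@measurableD _ (g_sigma_algebraType (history X (grid s u m j.+1)))).
    apply: (@history_mono _ _ _ X _ _ (grid_mono m su (leqnSn j))).
    by apply: (no_hit_history X_ci bc); exact: grid_ge0.
  by apply: (no_hit_history X_ci bc); exact: grid_ge0.
rewrite -(sumE (fun=> u)) [leRHS]integral_indicE le_eqVlt; apply/orP; left; apply/eqP.
by apply: eq_integral => w _; rewrite -mulr_suml grid_weight_sum.
Qed.

End stopping.

(** * The potential inequality *)

Section tonelli.
Context {d} {T : measurableType d} {R : realType} (P : probability T R).
Variables (D : set T) (f g : T -> R) (x : R).
Hypotheses (mD : measurable D) (mf : measurable_fun setT f) (mg : measurable_fun setT g).

Let F (p : T * T) : \bar R := (\1_D p.1 * pos (f p.1 + g p.2 - x))%:E.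

Let mF : measurable_fun setT F.
Proof.
apply/measurable_EFinP; apply: measurable_funM.
  by apply: measurableT_comp => //; exact: measurable_indic.
apply/measurable_EFinP; apply: measurable_pos; apply: measurable_funB => //.
by apply: measurable_funD; apply: measurableT_comp.
Qed.

Let F0 p : (0 <= F p)%E.
Proof. by rewrite lee_fin mulr_ge0// pos_ge0. Qed.

Lemma measurable_integral_pos_add :
  measurable_fun setT
    (fun w' => \int[P]_(w in D) (pos (f w + g w' - x))%:E)%E.
Proof.
under eq_fun do rewrite integral_indicE.
exact: (@measurable_fun_fubini_tonelli_G _ _ _ _ _ P _ mF F0).
Qed.

Lemma measurable_integral_pos_add_r :
  measurable_fun D (fun w => \int[P]_w' (pos (f w + g w' - x))%:E)%E.
Proof.
apply: (@eq_measurable_fun _ _ _ _ _ (fun w => \int[P]_w' F (w, w'))%E).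
  by move=> w Dw; apply: eq_integral => w' _; rewrite /F/= indicE Dw mul1r.
apply: measurable_funTS; exact: (@measurable_fun_fubini_tonelli_F _ _ _ _ _ P _ mF F0).
Qed.

Lemma integral_pos_add_swap :
  (\int[P]_w' \int[P]_(w in D) (pos (f w + g w' - x))%:E =
   \int[P]_(w in D) \int[P]_w' (pos (f w + g w' - x))%:E)%E.
Proof.
under eq_integral do rewrite integral_indicE.
rewrite -(@fubini_tonelli _ _ _ _ _ P P _ mF F0) [RHS]integral_mkcond.
apply: eq_integral => w _; rewrite patchE.
case: ifPn => Dw; first by apply: eq_integral => w' _; rewrite /F/= indicE Dw mul1r.
rewrite integral0_eq// => w' _.
by rewrite /F/= indicE (negbTE Dw) mul0r.
Qed.

End tonelli.

Section potential.
Context {d} {T : measurableType d} {R : realType} (P : probability T R).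
Variables (X : R -> T -> R) (K : R) (X_ci : centred_increments P X K).
Variables (b c : R -> \bar R) (bc : expanding_boundaries b c).

Local Notation A := (no_hit X b c).
Local Notation tau := (hitting_time X b c).
Local Notation Y := (hitting_value X b c).

Hypothesis tau_fin : {ae P, forall w, (tau w < +oo)%E}.
Hypothesis Y_int : P.-integrable setT (EFin \o Y).
Hypothesis Y_mean : 0 <= \int[P]_w Y w.

Local Notation mY := (measurable_hitting_value X_ci bc).

(** The functions [E pos (X (t /\ tau) - x)] and [E pos (Y - x)] of [x] differ only
    by the paths that are not yet stopped at time [t]. These are the contributions
    of those paths. *)
Definition running_potential s x : \bar R := (\int[P]_(w in A s) (pos (X s w - x))%:E)%E.
Definition final_potential s x : \bar R := (\int[P]_(w in A s) (pos (Y w - x))%:E)%E.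

Lemma measurable_pos_value (E : set T) x :
  measurable_fun E (fun w => (pos (Y w - x))%:E).
Proof.
by apply: measurable_funTS; apply: measurable_pos; apply: measurable_funB => //; exact: mY.
Qed.

Lemma final_potential_ge0 s x : (0 <= final_potential s x)%E.
Proof. by apply: integral_ge0 => w _; exact: epos_ge0. Qed.

(** To go from [s] to [u] one may pretend that paths which hit in between run on to
    time [u]: by optional stopping this overestimates what they contribute. *)
Lemma potential_le_of_restart s u x (k : R) : 0 <= s -> s <= u ->
  (\int[P]_(w in A s) (pos (X u w - x))%:E <= final_potential s x + k%:E)%E ->
  (running_potential u x <= final_potential u x + k%:E)%E.
Proof.
move=> s0 su; have u0 := le_trans s0 su.
have mAs := measurable_no_hit X_ci bc s0; have mAu := measurable_no_hit X_ci bc u0.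
have mAsu := measurable_no_hitD X_ci bc s0 su.
rewrite /final_potential (ge0_integral_setD _ mAs mAu)//; last 3 first.
- exact: no_hit_mono.
- exact: (measurable_pos_path X_ci).
- by move=> w _; exact: epos_ge0.
rewrite (ge0_integral_setD _ mAs mAu)//; last 3 first.
- exact: no_hit_mono.
- exact: measurable_pos_value.
- by move=> w _; exact: epos_ge0.
move=> le_su.
have f1 := integral_pos_path_lty X_ci x u0 mAsu.
rewrite -(@leeD2rE _ (\int[P]_(w in A s `\` A u) (pos (X u w - x))%:E)%E); last first.
  by rewrite ge0_fin_numE// integral_ge0// => w _; exact: epos_ge0.
apply: (le_trans le_su); rewrite -addeA [leRHS]addeAC -[leRHS]addeA addeC.
rewrite [leRHS]addeC leeD2r// leeD2r//.
exact: (hitting_value_submartingale X_ci bc).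
Qed.

(** This step is lossy, of the order of a single increment. It is only used after a
    time at which [x] lay near or beyond a boundary, where a bound is available from
    scratch, so its losses do not accumulate. *)
Lemma crude_potential_step s u x (k eta : R) : 0 <= s -> s <= u -> 0 < eta ->
  (running_potential s x <= final_potential s x + k%:E)%E ->
  (running_potential u x <=
   final_potential u x + (k + (eta + K * (u - s) ^+ 2 / eta ^+ 3))%:E)%E.
Proof.
move=> s0 su eta0 le_s; apply: (potential_le_of_restart s0 su).
have mAs := measurable_no_hit X_ci bc s0.
have mnI : measurable_fun setT (fun w => `|increment X s u w|%:E).
  apply/measurable_EFinP; apply: measurableT_comp => //.
  exact: (measurable_increment X_ci).
apply: (@le_trans _ _ (\int[P]_(w in A s)
   ((pos (X s w - x))%:E + `|increment X s u w|%:E))%E).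
  apply: ge0_le_integral => //.
  - by move=> w _; exact: epos_ge0.
  - exact: (measurable_pos_path X_ci).
  - apply: emeasurable_funD; first exact: (measurable_pos_path X_ci).
    exact: measurable_funTS.
  - move=> w _; rewrite -EFinD lee_fin /increment.
    rewrite ge_max addr_ge0 ?pos_ge0// andbT.
    have : X u w - X s w <= `|X u w - X s w| by exact: ler_norm.
    have : X s w - x <= pos (X s w - x) by rewrite le_max lexx.
    lra.
rewrite ge0_integralD//; last 3 first.
- by move=> w _; exact: epos_ge0.
- exact: (measurable_pos_path X_ci).
- exact: measurable_funTS.
rewrite EFinD [leRHS]addeA; apply: leeD; first exact: le_s.
apply: le_trans (increment_norm_moment X_ci s0 su eta0).
by apply: ge0_subset_integral => //.
Qed.

(** Averaging over an increment raises the convex function [pos] at [v] only if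
    the increment carries [v] across the kink at [0]. *)
Lemma integral_pos_add_increment s u (v dl : R) : 0 <= s -> s <= u -> 0 < dl ->
  dl <= `|v| ->
  (\int[P]_w (pos (v + increment X s u w))%:E <=
   (pos v + K * (u - s) ^+ 2 / dl ^+ 3)%:E)%E.
Proof.
move=> s0 su dl0 dlv.
pose I := increment X s u; rewrite -[increment X s u]/I.
have mI : measurable_fun setT I by exact: (measurable_increment X_ci).
have d30 : 0 <= (dl ^+ 3)^-1 by rewrite invr_ge0 exprn_ge0// ltW.
have mI4 : measurable_fun setT (fun w => (I w ^+ 4)%:E).
  by apply/measurable_EFinP; apply: measurable_funX.
have I40 w : (0 <= (I w ^+ 4)%:E)%E by rewrite lee_fin exprn_even_ge0.
have Q0 w : (0 <= (dl ^+ 3)^-1%:E * (I w ^+ 4)%:E)%E by rewrite mule_ge0.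
have mQ : measurable_fun setT (fun w => (dl ^+ 3)^-1%:E * (I w ^+ 4)%:E)%E.
  exact: measurable_funeM.
have Q_le : (\int[P]_w ((dl ^+ 3)^-1%:E * (I w ^+ 4)%:E) <=
    (K * (u - s) ^+ 2 / dl ^+ 3)%:E)%E.
  rewrite ge0_integralZl// [leRHS]EFinM [leRHS]muleC lee_wpmul2l//.
  exact: (increment_moment X_ci).
have mvI : measurable_fun setT (fun w => (pos (v + I w))%:E).
  by apply: measurable_pos; apply: measurable_funD.
have mpI := measurable_pos_increment X_ci (E := setT) s u.
have mnI := measurable_pos_incrementN X_ci (E := setT) s u.
have quart w : (dl ^+ 3)^-1 * I w ^+ 4 >= `|I w| - dl.
  by rewrite mulrC lerBlDl norm_le_quartic.
have [v0|v0] := leP 0 v; last first.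
  rewrite add0r; apply: le_trans Q_le; apply: ge0_le_integral => //.
  - by move=> w _; exact: epos_ge0.
  - move=> w _; have := Q0 w; rewrite -EFinM !lee_fin ge_max => -> /[!andbT].
    apply: le_trans (quart w); move: dlv; rewrite ltr0_norm// => dlv.
    have := ler_norm (I w).
    lra.
have [fp fn] := integral_pos_increment_lty X_ci s0 su measurableT.
rewrite -(@leeD2rE _ (\int[P]_w (pos (- I w))%:E)%E); last first.
  by rewrite ge0_fin_numE// integral_ge0// => w _; exact: epos_ge0.
rewrite [X in (_ <= _ + X)%E](_ : _ = \int[P]_w (pos (I w))%:E)%E; last first.
  by rewrite (increment_mean X_ci).
rewrite -ge0_integralD//; last 2 first.
- by move=> w _; exact: epos_ge0.
- by move=> w _; exact: epos_ge0.
apply: (@le_trans _ _ (\int[P]_w (v%:E + (dl ^+ 3)^-1%:E * (I w ^+ 4)%:E +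
    (pos (I w))%:E))%E).
  apply: ge0_le_integral => //.
  - by move=> w _; rewrite adde_ge0// epos_ge0.
  - exact: emeasurable_funD.
  - by apply: emeasurable_funD => //; apply: emeasurable_funD.
  - move=> w _; rewrite -EFinM -!EFinD lee_fin.
    move: dlv (quart w); rewrite ger0_norm// -/I => dlv.
    have [I0|I0] := leP 0 (I w).
      have -> : pos (- I w) = 0 by apply/max_idPr; rewrite oppr_le0.
      have -> : pos (v + I w) = v + I w by apply/max_idPl; rewrite addr_ge0.
      move=> _; have := Q0 w; rewrite -EFinM lee_fin; lra.
    have -> : pos (- I w) = - I w by apply/max_idPl; rewrite oppr_ge0 ltW.
    rewrite ltr0_norm// => ?; have := Q0 w; rewrite -EFinM lee_fin => ?.
    have [vI|vI] := leP 0 (v + I w).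
      lra.
    lra.
rewrite ge0_integralD//; last 3 first.
- by move=> w _; rewrite adde_ge0.
- exact: emeasurable_funD.
- by move=> w _; exact: epos_ge0.
rewrite leeD2r// ge0_integralD// integral_cst//= probability_setT mule1 EFinD.
by rewrite leeD2l.
Qed.

Lemma moment_bound_ge0 s u (dl : R) : 0 <= s -> s <= u -> 0 < dl ->
  0 <= K * (u - s) ^+ 2 / dl ^+ 3.
Proof.
move=> s0 su dl0; apply: divr_ge0; last by rewrite exprn_ge0// ltW.
rewrite -lee_fin; apply: le_trans (increment_moment X_ci s0 su).
by apply: integral_ge0 => w _; rewrite lee_fin exprn_even_ge0.
Qed.

(** Averaging over the increment from [s] to [u] moves the running potential one step
    on. It hardly changes the final one when [x] is far inside the boundaries: there
    [Y] keeps a distance [dl] from [x], and [pos] is linear away from its kink. A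
    bound that is uniform in [x] therefore survives, with an error of second order
    in the step. *)
Lemma inner_potential_step s u x (k dl : R) : 0 < s -> s <= u -> 0 < dl -> 0 <= k ->
  ((x + dl)%:E <= b s)%E -> (c s <= (x - dl)%:E)%E ->
  (forall x', running_potential s x' <= final_potential s x' + k%:E)%E ->
  (running_potential u x <=
   final_potential u x + (k + K * (u - s) ^+ 2 / dl ^+ 3)%:E)%E.
Proof.
move=> s0 su dl0 k0 xb cx le_s; apply: (potential_le_of_restart (ltW s0) su).
have mAs := measurable_no_hit X_ci bc (ltW s0).
have mI := measurable_increment X_ci s u.
have mXs := path_measurable X_ci s.
have FAs := no_hit_history X_ci bc (ltW s0).
have kap0 := moment_bound_ge0 (ltW s0) su dl0.
rewrite (integral_pos_path_increment X_ci _ (ltW s0) su FAs).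
have shiftE (f : T -> R) w w' : f w + increment X s u w' - x =
  f w - (x - increment X s u w') by ring.
apply: (@le_trans _ _ (\int[P]_w' ((\int[P]_(w in A s)
    (pos (Y w + increment X s u w' - x))%:E) + k%:E))%E).
  apply: ge0_le_integral => //.
  - by move=> w' _; apply: integral_ge0 => w _; exact: epos_ge0.
  - exact: measurable_integral_pos_add.
  - by apply: emeasurable_funD => //; apply: measurable_integral_pos_add => //; exact: mY.
  - move=> w' _; have := le_s (x - increment X s u w').
    rewrite /running_potential /final_potential.
    under eq_integral do rewrite -shiftE.
    by under [in X in (_ <= X)%E -> _]eq_integral do rewrite -shiftE.
rewrite ge0_integralD//; last 2 first.
- by move=> w' _; apply: integral_ge0 => w _; exact: epos_ge0.
- by apply: measurable_integral_pos_add => //; exact: mY.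
rewrite integral_cst//= probability_setT mule1 [(k + _)%R]addrC EFinD [leRHS]addeA.
apply: leeD => //; rewrite integral_pos_add_swap//; last exact: mY.
apply: (@le_trans _ _ (\int[P]_(w in A s) ((pos (Y w - x))%:E +
    (K * (u - s) ^+ 2 / dl ^+ 3)%:E))%E).
  apply: ae_ge0_le_integral => //.
  - by move=> w _; apply: integral_ge0 => w' _; exact: epos_ge0.
  - by apply: measurable_integral_pos_add_r => //; exact: mY.
  - by move=> w _; rewrite adde_ge0// epos_ge0.
  - by apply: emeasurable_funD => //; exact: measurable_pos_value.
  - apply: filterS tau_fin => w tau_w Asw.
    have Ydl : dl <= `|Y w - x|.
      have [bY|Yc] := hitting_value_outside X_ci bc s0 Asw tau_w.
        have : x + dl <= Y w by rewrite -lee_fin; exact: le_trans bY.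
        by move=> ?; apply: le_trans (ler_norm _); lra.
      have : Y w <= x - dl by rewrite -lee_fin; exact: le_trans cx.
      by move=> ?; rewrite -normrN; apply: le_trans (ler_norm _); lra.
    rewrite -EFinD; apply: le_trans (integral_pos_add_increment (ltW s0) su dl0 Ydl).
    by under [leRHS]eq_integral do rewrite addrAC.
rewrite ge0_integralD//; last 2 first.
- by move=> w _; exact: epos_ge0.
- exact: measurable_pos_value.
rewrite integral_cst//; apply: leeD => //.
by rewrite -[leRHS]mule1 lee_wpmul2l ?lee_fin// probability_le1.
Qed.

(** Before the hit, the process stays below [b s]. *)
Lemma upper_potential_bound s x (dl : R) : 0 < s -> 0 <= dl -> (b s <= (x + dl)%:E)%E ->
  (running_potential s x <= final_potential s x + dl%:E)%E.
Proof.
move=> s0 dl0 bx; have mAs := measurable_no_hit X_ci bc (ltW s0).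
apply: (@le_trans _ _ (\int[P]_(w in A s) dl%:E)%E).
  apply: ge0_le_integral => //.
  - by move=> w _; exact: epos_ge0.
  - exact: (measurable_pos_path X_ci).
  - move=> w /(_ s); rewrite s0 lexx => /(_ isT)/andP[_ Xb].
    rewrite lee_fin ge_max dl0 andbT lerBlDl -lee_fin.
    by apply: le_trans bx; exact: ltW.
rewrite integral_cst// -[leLHS]add0e; apply: leeD; first exact: final_potential_ge0.
by rewrite -[leRHS]mule1 lee_wpmul2l ?lee_fin// probability_le1.
Qed.

Lemma path_integrable s : 0 <= s -> P.-integrable setT (EFin \o X s).
Proof.
move=> s0; apply/integrableP; split.
  by apply/measurable_EFinP; exact: (path_measurable X_ci).
apply: (@integral_le_increment_lty _ _ _ _ _ _ X_ci 0 s _ (fun w => `|X s w|) 0) => //.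
- by apply: measurableT_comp => //; exact: (path_measurable X_ci).
- by move=> w; rewrite addr0 (path_increment X_ci).
Qed.

Lemma EFin_Rintegral D (f : T -> R) : measurable D ->
  P.-integrable D (EFin \o f) ->
  (\int[P]_(w in D) f w)%:E = (\int[P]_(w in D) (f w)%:E)%E.
Proof. by move=> mD fi; rewrite /Rintegral fineK// integrable_fin_num. Qed.

Lemma path_mean s : 0 <= s -> \int[P]_w X s w = 0.
Proof.
move=> s0; have := increment_mean X_ci (lexx 0) s0.
rewrite /Rintegral integralE => E.
have -> : (\int[P]_x (fun x => (X s x)%:E)^\+ x =
   \int[P]_x (fun x => (X s x)%:E)^\- x)%E.
  transitivity (\int[P]_w (pos (increment X 0 s w))%:E)%E.
    by apply: eq_integral => w _; rewrite funeposE -(path_increment X_ci) EFin_max.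
  by rewrite E; apply: eq_integral => w _; rewrite funenegE -(path_increment X_ci) EFin_max.
rewrite subee// integrable_neg_fin_num//.
exact: path_integrable.
Qed.

Lemma integrable_pos_sub D (f : T -> R) x : measurable D ->
  P.-integrable D (EFin \o f) -> P.-integrable D (fun w => (pos (f w - x))%:E).
Proof.
move=> mD fi; have mf : measurable_fun D f.
  by apply/measurable_EFinP; exact: measurable_int fi.
apply: (@le_integrable _ _ _ P _ mD _ (fun w => (f w)%:E - x%:E)%E).
- by apply: measurable_pos; exact: measurable_funB.
- move=> w _; rewrite -EFinB /= lee_fin ger0_norm ?pos_ge0//.
  by rewrite ge_max normr_ge0 ler_norm.
- by apply: integrableB => //; exact: finite_measure_integrable_cst.
Qed.

Lemma Rintegral_addr D (f : T -> R) x : measurable D ->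
  P.-integrable D (EFin \o f) ->
  \int[P]_(w in D) (f w + x) = \int[P]_(w in D) f w + x * fine (P D).
Proof.
move=> mD fi; rewrite RintegralD//; last exact: finite_measure_integrable_cst.
by rewrite Rintegral_cst.
Qed.

(** The mean at the hit is at most the mean at [s], because a truncation
    [pos (_ + k)] from below changes the latter by at most a fourth moment over
    [k ^+ 3]. *)
Lemma hit_mean_le s : 0 <= s ->
  \int[P]_(w in ~` A s) Y w <= \int[P]_(w in ~` A s) X s w.
Proof.
move=> s0; have mD : measurable (~` A s).
  by apply: measurableC; exact: (measurable_no_hit X_ci bc).
have DE : A 0 `\` A s = ~` A s by rewrite no_hit0 setTD.
apply/ler_addgt0Pr => e e0.
pose M := K * s ^+ 2.
(* [k >= 1] gives [k <= k ^+ 3], so the error [M / k ^+ 3] is at most [e] *)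
pose k := Num.max 1 (M / e).
have k1 : 1 <= k by rewrite le_max lexx.
have k0 : 0 < k by exact: lt_le_trans ltr01 k1.
have Mk : M / k ^+ 3 <= e.
  rewrite ler_pdivrMr ?exprn_gt0// mulrC -ler_pdivrMr//.
  apply: (@le_trans _ _ k); first by rewrite le_max lexx orbT.
  by apply: ler_eXnr.
have iX := path_integrable s0.
have mX := path_measurable X_ci s.
have iYD : P.-integrable (~` A s) (EFin \o Y) by exact: integrableS Y_int.
have iXD : P.-integrable (~` A s) (EFin \o X s) by exact: integrableS iX.
pose q w := X s w ^+ 4 / k ^+ 3.
have q0 w : 0 <= q w.
  by apply: divr_ge0; [exact: exprn_even_ge0|rewrite exprn_ge0// ltW].
have mq : measurable_fun setT q by apply: measurable_funM => //; exact: measurable_funX.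
have q_le : (\int[P]_w (q w)%:E <= (M / k ^+ 3)%:E)%E.
  have -> : (\int[P]_w (q w)%:E =
      (k ^+ 3)^-1%:E * \int[P]_w (increment X 0 s w ^+ 4)%:E)%E.
    rewrite -ge0_integralZl//.
    - apply: eq_integral => w _.
      by rewrite /q mulrC EFinM (path_increment X_ci).
    - apply/measurable_EFinP; apply: measurable_funX.
      exact: (measurable_increment X_ci).
    - by move=> w _; rewrite lee_fin exprn_even_ge0.
    - by rewrite lee_fin invr_ge0 exprn_ge0// ltW.
  rewrite [leRHS]EFinM [leRHS]muleC lee_wpmul2l//.
    by rewrite lee_fin invr_ge0 exprn_ge0// ltW.
  by have := increment_moment X_ci (lexx 0) s0; rewrite subr0.
have iq : P.-integrable setT (EFin \o q).
  apply/integrableP; split; first exact/measurable_EFinP.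
  apply: le_lt_trans (ltry (M / k ^+ 3)); apply: le_trans q_le.
  by under eq_integral do rewrite /= ger0_norm//.
have iqD : P.-integrable (~` A s) (EFin \o q) by exact: integrableS iq.
have qD_le : \int[P]_(w in ~` A s) q w <= e.
  apply: le_trans Mk; rewrite -lee_fin EFin_Rintegral//; apply: le_trans q_le.
  apply: ge0_subset_integral => //; first exact/measurable_EFinP.
  by move=> w _; rewrite lee_fin.
have iYp := integrable_pos_sub (- k) mD iYD.
have iXp := integrable_pos_sub (- k) mD iXD.
have stop : \int[P]_(w in ~` A s) pos (Y w - - k) <= \int[P]_(w in ~` A s) pos (X s w - - k).
  rewrite -lee_fin !EFin_Rintegral// -DE.
  exact: (hitting_value_submartingale X_ci bc).
have ik : P.-integrable (~` A s) (EFin \o cst k) by exact: finite_measure_integrable_cst.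
have Yk : \int[P]_(w in ~` A s) (Y w + k) <= \int[P]_(w in ~` A s) pos (Y w - - k).
  apply: le_Rintegral => //; first exact: (integrableD mD iYD ik).
  by move=> w _; rewrite opprK le_max lexx.
have Xk : \int[P]_(w in ~` A s) pos (X s w - - k) <=
    \int[P]_(w in ~` A s) (X s w + k + q w).
  apply: le_Rintegral => //; first exact: (integrableD mD (integrableD mD iXD ik) iqD).
  move=> w _; rewrite opprK ge_max.
  have := norm_le_quartic (X s w) k0; have := ler_norm (- X s w); rewrite normrN.
  have := q0 w; rewrite -/(q w) => *.
  apply/andP; split; lra.
move: Xk; rewrite RintegralD//; last exact: (integrableD mD iXD ik).
move: Yk; rewrite !Rintegral_addr//; lra.
Qed.

(** The nonnegative mean of the law enters here: it makes the mean of the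
    process before the hit at most the mean that is still to come. *)
Lemma lower_potential_bound s x (dl : R) : 0 < s -> 0 <= dl -> ((x - dl)%:E <= c s)%E ->
  (running_potential s x <= final_potential s x + dl%:E)%E.
Proof.
move=> s0 dl0 xc; have mA := measurable_no_hit X_ci bc (ltW s0).
have mD : measurable (~` A s) by exact: measurableC.
have iX := path_integrable (ltW s0).
have iXA : P.-integrable (A s) (EFin \o X s) by exact: integrableS iX.
have iYA : P.-integrable (A s) (EFin \o Y) by exact: integrableS Y_int.
have iYp := integrable_pos_sub x mA iYA.
have iXp := integrable_pos_sub x mA iXA.
rewrite /running_potential /final_potential -!EFin_Rintegral// -EFinD lee_fin.
have iN (r : R) : P.-integrable (A s) (EFin \o cst r) by exact: finite_measure_integrable_cst.
have Yx : \int[P]_(w in A s) (Y w + - x) <= \int[P]_(w in A s) pos (Y w - x).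
  apply: le_Rintegral => //; first exact: (integrableD mA iYA (iN (- x))).
  by move=> w _; rewrite le_max lexx.
have Xx : \int[P]_(w in A s) pos (X s w - x) <= \int[P]_(w in A s) (X s w + (dl - x)).
  apply: le_Rintegral => //; first exact: (integrableD mA iXA (iN (dl - x))).
  move=> w /(_ s); rewrite s0 lexx => /(_ isT)/andP[cX _].
  have : x - dl <= X s w by rewrite -lee_fin (le_trans xc)// ltW.
  by move=> ?; rewrite ge_max; apply/andP; split; lra.
have XT : \int[P]_w X s w = \int[P]_(w in A s) X s w + \int[P]_(w in ~` A s) X s w.
  rewrite -Rintegral_setU// ?setUv//; exact/disj_setPCl.
have YT : \int[P]_w Y w = \int[P]_(w in A s) Y w + \int[P]_(w in ~` A s) Y w.
  rewrite -Rintegral_setU// ?setUv//; exact/disj_setPCl.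
have := hit_mean_le (ltW s0); have := path_mean (ltW s0).
move: Y_mean; rewrite XT YT.
move: Yx Xx; rewrite !Rintegral_addr//.
have PA1 : fine (P (A s)) <= 1 by rewrite -lee_fin fineK ?fin_num_measure// probability_le1.
have := ler_wpM2l dl0 PA1; lra.
Qed.

Lemma initial_potential x : (running_potential 0 x <= final_potential 0 x + 0%:E)%E.
Proof.
rewrite adde0 /running_potential /final_potential no_hit0.
have iYp := integrable_pos_sub x measurableT Y_int.
under eq_integral do rewrite (path_start X_ci) sub0r.
rewrite integral_cst//= probability_setT mule1 -EFin_Rintegral// lee_fin ge_max.
apply/andP; split; last by apply: Rintegral_ge0 => w _; exact: pos_ge0.
have ix : P.-integrable setT (EFin \o cst (- x)) by exact: finite_measure_integrable_cst.
apply: (@le_trans _ _ (\int[P]_w (Y w + - x))).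
  by rewrite Rintegral_addr//= probability_setT /= mulr1 lerDr.
apply: le_Rintegral => //; first exact: (integrableD measurableT Y_int ix).
by move=> w _; rewrite le_max lexx.
Qed.

(** A discrete maximum principle. The noncylindrical domain between the boundaries
    expands, so going back in time from an inner point one leaves it through a
    boundary, where the inequality holds up to [dl]. Only inner steps add to the
    error. *)
Lemma grid_potential_bound (t dl : R) (m k : nat) x : 0 <= t -> 0 < dl ->
  (running_potential (grid 0 t m k) x <= final_potential (grid 0 t m k) x +
    (2 * dl + k%:R * (K * (t / m.+1%:R) ^+ 2 / dl ^+ 3))%:E)%E.
Proof.
move=> t0 dl0; set kap := K * _ / _.
elim: k x => [x|k IH x].
  rewrite grid0 mul0r addr0; apply: le_trans (initial_potential x) _.
  by rewrite leeD2l// lee_fin mulr_ge0// ltW.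
have gk0 := grid_ge0 m k (lexx 0) t0.
have gkS : grid 0 t m k <= grid 0 t m k.+1 by exact: grid_mono.
have step : grid 0 t m k.+1 - grid 0 t m k = t / m.+1%:R.
  by rewrite gridS subr0 addrAC subrr add0r.
have kap0 : 0 <= kap by have := moment_bound_ge0 gk0 gkS dl0; rewrite step.
have kkap0 : 0 <= k%:R * kap by rewrite mulr_ge0.
have crude r : r <= dl -> (running_potential (grid 0 t m k) x <=
    final_potential (grid 0 t m k) x + r%:E)%E ->
    (running_potential (grid 0 t m k.+1) x <= final_potential (grid 0 t m k.+1) x +
      (2 * dl + k.+1%:R * kap)%:E)%E.
  move=> rdl le_r; apply: le_trans (crude_potential_step gk0 gkS dl0 le_r) _.
  by rewrite step -/kap leeD2l// lee_fin -natr1 mulrDl mul1r; lra.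
move: gk0; rewrite le_eqVlt => /orP[/eqP gk0|gk0].
  by apply: (crude 0); [exact: ltW|rewrite -gk0; exact: initial_potential].
have [xb|bx] := leP (x + dl)%:E (b (grid 0 t m k)); last first.
  by apply: (crude dl) => //; apply: upper_potential_bound => //; exact: ltW.
have [cx|xc] := leP (c (grid 0 t m k)) (x - dl)%:E; last first.
  by apply: (crude dl) => //; apply: lower_potential_bound => //; exact: ltW.
have k0 : 0 <= 2 * dl + k%:R * kap by rewrite addr_ge0// mulr_ge0// ltW.
apply: le_trans (inner_potential_step gk0 gkS dl0 k0 xb cx IH) _.
by rewrite step -/kap leeD2l// lee_fin -natr1 mulrDl mul1r; lra.
Qed.

(** The mesh tends to [0] first, for a fixed margin [dl] around the boundaries. *)
Lemma potential_le t x : 0 <= t ->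
  (running_potential t x <= final_potential t x)%E.
Proof.
move=> t0; apply/lee_addgt0Pr => e e0.
pose dl := e / 3.
have dl0 : 0 < dl by rewrite divr_gt0.
pose M := K * t ^+ 2 / dl ^+ 3.
have M0 : 0 <= M by have := moment_bound_ge0 (lexx 0) t0 dl0; rewrite subr0.
have Mdl : 0 < dl / (M + 1) by rewrite divr_gt0// ltr_wpDl.
have [m mM] : exists m : nat, m.+1%:R^-1 < dl / (M + 1).
  by have [m _ /(_ m (leqnn m))] := near_infty_natSinv_lt (PosNum Mdl); exists m.
have := grid_potential_bound m m.+1 x t0 dl0; rewrite grid_max => /le_trans; apply.
rewrite leeD2l// lee_fin.
have -> : m.+1%:R * (K * (t / m.+1%:R) ^+ 2 / dl ^+ 3) = M / m.+1%:R.
  have m0 : m.+1%:R != 0 :> R by rewrite pnatr_eq0.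
  rewrite /M -[RHS](mulKf m0) expr_div_n !expr2 invfM; move: m.+1%:R => n; ring.
have : M / m.+1%:R <= dl.
  apply: (@le_trans _ _ ((M + 1) * m.+1%:R^-1)).
    by rewrite ler_wpM2r ?invr_ge0// lerDl.
  by rewrite mulrC -ler_pdivlMr ?ltr_wpDl// ltW.
have : dl * 3 = e by rewrite divfK.
by move: (M / _) => r; lra.
Qed.

End potential.

(** * Uniform integrability *)

Section uniform_integrability.
Context {d} {T : measurableType d} {R : realType} (P : probability T R).

(** The tail condition of uniform integrability with the supremum and the limit
    unfolded, so that tails of positive and negative parts can be added. *)
Definition uniform_tails (D : set R) (Z : R -> T -> R) : Prop :=
  forall e : R, 0 < e -> exists K0 : R, forall K t, K0 <= K -> D t ->
    (\int[P]_(w in [set w | (K <= `|Z t w|)%R]) `|Z t w|%:E <= e%:E)%E.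

Lemma uniform_tails_integrable (D : set R) (Z : R -> T -> R) : D !=set0 ->
  (forall t, D t -> measurable_fun setT (Z t)) ->
  uniform_tails D Z -> uniformly_integrable P D Z.
Proof.
move=> [t0 Dt0] mZ tZ; split => //.
set S := (fun K : R => ereal_sup _).
have S0 K : (0 <= S K)%E.
  apply: (@le_trans _ _ (\int[P]_(w in [set w | (K <= `|Z t0 w|)%R]) `|Z t0 w|%:E)%E).
    by apply: integral_ge0 => w _; rewrite lee_fin.
  by apply: ereal_sup_ubound; exists t0.
have S_le e : 0 < e -> \forall K \near +oo, (S K <= e%:E)%E.
  move=> /tZ[K0 K0P]; exists K0; split; first exact: num_real.
  move=> K K0K; apply: ge_ereal_sup => _ [t Dt <-].
  exact: K0P (ltW K0K) Dt.
apply/fine_cvgP; split.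
  apply: filterS (S_le 1 ltr01) => K SK.
  by rewrite ge0_fin_numE// (le_lt_trans SK)// ltry.
apply/cvgrPdist_le => e e0; apply: filterS (S_le e e0) => K SK.
rewrite /= sub0r normrN ger0_norm ?fine_ge0// -lee_fin fineK//.
by rewrite ge0_fin_numE// (le_lt_trans SK)// ltry.
Qed.

Lemma uniform_tails_norm (D : set R) (Z : R -> T -> R) :
  (forall t, D t -> measurable_fun setT (Z t)) ->
  uniform_tails D (fun t w => pos (Z t w)) ->
  uniform_tails D (fun t w => pos (- Z t w)) -> uniform_tails D Z.
Proof.
move=> mZ tp tn e e0; have e20 : 0 < e / 2 by rewrite divr_gt0.
have [Kp Kp_le] := tp _ e20; have [Kn Kn_le] := tn _ e20.
exists (Num.max 1 (Num.max Kp Kn)) => K t.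
rewrite !ge_max => /andP[K1 /andP[KpK KnK]] Dt.
have K0 : 0 < K by exact: lt_le_trans ltr01 K1.
have mset (f : T -> R) : measurable_fun setT f -> measurable [set w | (K <= `|f w|)%R].
  move=> mf; rewrite -[X in measurable X]setTI.
  apply: measurable_fun_le => //; exact: measurableT_comp.
have mp : measurable_fun setT (fun w => pos (Z t w)).
  by apply/measurable_EFinP; apply: measurable_pos; exact: mZ.
have mn : measurable_fun setT (fun w => pos (- Z t w)).
  by apply/measurable_EFinP; apply: measurable_pos; apply: measurableT_comp => //; exact: mZ.
have UE : [set w | (K <= `|Z t w|)%R] =
    [set w | (K <= `|pos (Z t w)|)%R] `|` [set w | (K <= `|pos (- Z t w)|)%R].
  apply/seteqP; split => w /=; rewrite !(ger0_norm (pos_ge0 _)).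
    have [Z0|Z0] := leP 0 (Z t w); first by rewrite ger0_norm//; left.
    by rewrite ltr0_norm// => KZ; right; rewrite le_max KZ.
  case; rewrite le_max => /orP[KZ|]; try by rewrite leNgt K0.
    exact: le_trans (ler_norm _).
  by rewrite -normrN; exact: le_trans (ler_norm _).
rewrite UE ge0_integral_setU//; last 4 first.
- exact: mset.
- exact: mset.
- by apply/measurable_EFinP; apply: measurable_funTS; apply: measurableT_comp => //; exact: mZ.
- apply/disj_setPS => w [/=]; rewrite !(ger0_norm (pos_ge0 _)) !le_max.
  by rewrite [K <= 0]leNgt K0 !orbF => ? ?; lra.
have -> : e%:E = ((e / 2)%:E + (e / 2)%:E)%E by rewrite -EFinD; congr EFin; lra.
apply: leeD.
- apply: le_trans (Kp_le K t KpK Dt).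
  rewrite le_eqVlt; apply/orP; left; apply/eqP; apply: eq_integral => w.
  rewrite inE /= !(ger0_norm (pos_ge0 _)) le_max [K <= 0]leNgt K0 orbF => KZ.
  have Z0 : 0 <= Z t w by lra.
  by rewrite ger0_norm//; congr EFin; apply/esym/max_idPl.
- apply: le_trans (Kn_le K t KnK Dt).
  rewrite le_eqVlt; apply/orP; left; apply/eqP; apply: eq_integral => w.
  rewrite inE /= !(ger0_norm (pos_ge0 _)) le_max [K <= 0]leNgt K0 orbF => KZ.
  have Z0 : Z t w <= 0 by lra.
  by rewrite ler0_norm//; congr EFin; apply/esym/max_idPl; rewrite oppr_ge0.
Qed.

(** Dominated convergence. *)
Lemma small_integral_vanishing (D : (set T)^nat) (f : T -> R) :
  (forall n, measurable (D n)) -> P.-integrable setT (EFin \o f) ->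
  (forall w, 0 <= f w) -> {ae P, forall w, exists n, forall m, (n <= m)%N -> ~ D m w} ->
  forall e : R, 0 < e -> exists n, (\int[P]_(w in D n) (f w)%:E <= e%:E)%E.
Proof.
move=> mD fi f0 D0 e e0.
have mf : measurable_fun setT f by apply/measurable_EFinP; exact: measurable_int fi.
pose g n w := (\1_(D n) w * f w)%:E.
have [//|||||_ _ g_cvg] := @dominated_convergence _ _ _ P setT measurableT g (cst 0%E) (EFin \o f).
- by move=> n; apply/measurable_EFinP; apply: measurable_funM => //; exact: measurable_indic.
- exact: measurable_cst.
- apply: filterS D0 => w [n nD] _; apply: cvg_near_cst; exists n => // m /= nm.
  by rewrite /g indicE memNset ?mul0r//; exact: nD.
- exact: fi.
- apply: nearW => w n _; rewrite /g /= lee_fin normrM ger0_norm// [`|f w|]ger0_norm//.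
  by rewrite indicE; case: (_ \in _); rewrite ?mul1r// mul0r.
move: g_cvg; rewrite integral0 => /fine_cvgP[g_fin /cvgrPdist_le/(_ e e0)] g_le.
have [n _ /(_ n (leqnn n)) []] := filterI g_fin g_le; rewrite sub0r normrN => gf ge.
have gf' : (\int[P]_w g n w)%E \is a fin_num by exact: gf.
exists n; rewrite integral_indicE -[leLHS](fineK gf') lee_fin; exact: le_trans (ler_norm _) ge.
Qed.

End uniform_integrability.

Section stopped_tails.
Context {d} {T : measurableType d} {R : realType} (P : probability T R).
Variables (X : R -> T -> R) (Kc : R) (X_ci : centred_increments P X Kc).
Variables (b c : R -> \bar R) (bc : expanding_boundaries b c).

Local Notation A := (no_hit X b c).
Local Notation tau := (hitting_time X b c).
Local Notation Y := (hitting_value X b c).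

Hypothesis tau_fin : {ae P, forall w, (tau w < +oo)%E}.

Lemma stopped_before t w : A t w -> stopped X tau t w = X t w.
Proof.
by move=> /no_hit_le_hitting_time tw; rewrite /stopped min_l.
Qed.

Lemma stopped_after t w : ~ A t w -> stopped X tau t w = Y w.
Proof.
by move=> /hit_hitting_time_le tw; rewrite /stopped min_r.
Qed.

Lemma measurable_stopped t : 0 <= t -> measurable_fun setT (stopped X tau t).
Proof.
move=> t0; have mA := measurable_no_hit X_ci bc t0.
rewrite (_ : stopped X tau t =
  (fun w => \1_(A t) w * X t w + \1_(~` A t) w * Y w)).
  apply: measurable_funD; apply: measurable_funM.
  - exact: measurable_indic.
  - exact: (path_measurable X_ci).
  - by apply: measurable_indic; exact: measurableC.
  - exact: (measurable_hitting_value X_ci bc).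
apply/funext => w; rewrite !indicE in_setC.
have [/set_mem Aw|/negP Aw] := boolP (w \in A t).
  by rewrite stopped_before// mul1r mul0r addr0.
by rewrite stopped_after ?mul1r ?mul0r ?add0r// => /mem_set.
Qed.

Hypothesis Y_int : P.-integrable setT (EFin \o Y).
Hypothesis Y_mean : 0 <= \int[P]_w Y w.

Let mY := measurable_hitting_value X_ci bc.

(** After the hit the stopped process is the single integrable variable [Y].
    Before the hit, its positive part is small in mean at late times by the
    potential inequality, and at early times it has bounded fourth moments. *)
Lemma stopped_pos_uniform_tails :
  uniform_tails P [set t | 0 <= t] (fun t w => pos (stopped X tau t w)).
Proof.
move=> e e0; have e30 : 0 < e / 3 by rewrite divr_gt0.
pose f w := pos (Y w).
have f0 w : 0 <= f w by exact: pos_ge0.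
have mf : measurable_fun setT f by apply/measurable_EFinP; exact: measurable_pos.
have fi : P.-integrable setT (EFin \o f).
  apply: (@le_integrable _ _ _ P _ measurableT _ (EFin \o Y)) => //.
  - exact/measurable_EFinP.
  - by move=> w _; rewrite lee_fin ger0_norm// ge_max normr_ge0 ler_norm.
have mtail (g : T -> R) K : measurable_fun setT g -> measurable [set w | K <= g w].
  by move=> mg; rewrite -[X in measurable X]setTI; exact: measurable_fun_le.
have [n0 tailY] : exists n : nat, (\int[P]_(w in [set w | (n%:R <= f w)%R]) (f w)%:E <= (e / 3)%:E)%E.
  apply: small_integral_vanishing => //; first by move=> n; exact: mtail.
  apply: nearW => w; exists (Num.truncn (f w)).+1 => m fm.
  apply/negP; rewrite -ltNge; apply: (@lt_le_trans _ _ (Num.truncn (f w)).+1%:R).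
    exact: truncnS_gt.
  by rewrite ler_nat.
have [n1 lateY] : exists n : nat, (\int[P]_(w in A n%:R) (f w)%:E <= (e / 3)%:E)%E.
  apply: small_integral_vanishing => //.
    by move=> n; exact: (measurable_no_hit X_ci bc).
  apply: filterS tau_fin => w tau_w; exists (Num.truncn (fine (tau w))).+1 => m tm.
  move=> /no_hit_le_hitting_time; apply/negP; rewrite -ltNge.
  have tau_w' : tau w \is a fin_num by rewrite ge0_fin_numE// hitting_time_ge0.
  rewrite -(fineK tau_w') lte_fin.
  apply: (@lt_le_trans _ _ (Num.truncn (fine (tau w))).+1%:R).
    exact: truncnS_gt.
  by rewrite ler_nat.
pose M := Kc * n1%:R ^+ 2.
have M0 : 0 <= M.
  by have := moment_bound_ge0 X_ci (lexx 0) (ler0n R n1) ltr01; rewrite subr0 expr1n divr1.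
(* [n0] serves the stopped paths, [M / (e / 3)] those still running before [n1] *)
exists (Num.max n0%:R (Num.max 1 (M / (e / 3)))) => K t.
rewrite !ge_max => /and3P[n0K K1 MK] /= t0.
have K0 : 0 < K by exact: lt_le_trans ltr01 K1.
have mA := measurable_no_hit X_ci bc t0.
pose Z w := pos (stopped X tau t w).
have mZ : measurable_fun setT Z.
  by apply/measurable_EFinP; apply: measurable_pos; exact: measurable_stopped.
have ZE w : `|pos (stopped X tau t w)| = Z w by rewrite ger0_norm ?pos_ge0.
have -> : [set w | (K <= `|pos (stopped X tau t w)|)%R] = [set w | K <= Z w].
  by apply/seteqP; split => w /=; rewrite ZE.
under eq_integral do rewrite ZE.
pose E := [set w | K <= Z w].
have mE : measurable E by exact: mtail.
have mEA : measurable (E `&` A t) by exact: measurableI.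
have mEA' : measurable (E `\` A t) by exact: measurableD.
have Z0 w : (0 <= (Z w)%:E)%E by exact: epos_ge0.
have eE : e%:E = ((e / 3 + e / 3)%:E + (e / 3)%:E)%E by rewrite -EFinD; congr EFin; lra.
rewrite -/E (@ge0_integral_setD _ _ _ _ E (E `&` A t))//; last first.
  by apply/measurable_EFinP; exact: measurable_funTS.
rewrite setDIr setDv set0U eE; apply: leeD; last first.
  apply: le_trans tailY.
  rewrite (_ : (\int[P]_(w in E `\` A t) (Z w)%:E =
      \int[P]_(w in E `\` A t) (f w)%:E)%E); last first.
    apply: eq_integral => w; rewrite inE => -[_ nA].
    by rewrite /Z stopped_after.
  apply: ge0_subset_integral => //.
  - exact: mtail.
  - by apply/measurable_EFinP; exact: measurable_funTS.
  - by move=> w _; rewrite lee_fin.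
  - move=> w [/= KZ nA]; apply: (le_trans n0K); apply: (le_trans KZ).
    by rewrite /Z stopped_after.
have -> : (\int[P]_(w in E `&` A t) (Z w)%:E =
    \int[P]_(w in E `&` A t) (pos (X t w - 0))%:E)%E.
  apply: eq_integral => w; rewrite inE => -[_ Aw].
  by rewrite /Z stopped_before// subr0.
have [n1t|tn1] := leP n1%:R t.
  apply: (@le_trans _ _ (running_potential P X b c t 0)).
    apply: ge0_subset_integral => //; first exact: (measurable_pos_path X_ci).
    by move=> w _; exact: epos_ge0.
  apply: (le_trans (potential_le X_ci bc tau_fin Y_int Y_mean 0 t0)).
  apply: (@le_trans _ _ (e / 3)%:E); last by rewrite lee_fin lerDl ltW.
  apply: le_trans lateY; rewrite /final_potential.
  under eq_integral do rewrite subr0.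
  apply: ge0_subset_integral => //.
  - exact: (measurable_no_hit X_ci bc).
  - by apply/measurable_EFinP; exact: measurable_funTS.
  - by move=> w _; exact: epos_ge0.
  - exact: no_hit_mono.
have K30 : 0 <= (K ^+ 3)^-1 by rewrite invr_ge0 exprn_ge0// ltW.
have mI4 : measurable_fun setT (fun w => (increment X 0 t w ^+ 4)%:E).
  apply/measurable_EFinP; apply: measurable_funX.
  exact: (measurable_increment X_ci).
have I40 w : (0 <= (increment X 0 t w ^+ 4)%:E)%E by rewrite lee_fin exprn_even_ge0.
apply: (@le_trans _ _ (\int[P]_w ((K ^+ 3)^-1%:E * (increment X 0 t w ^+ 4)%:E))%E).
  apply: (@le_trans _ _ (\int[P]_(w in E `&` A t)
      ((K ^+ 3)^-1%:E * (increment X 0 t w ^+ 4)%:E))%E).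
    apply: ge0_le_integral => //.
    - by move=> w _; exact: epos_ge0.
    - exact: (measurable_pos_path X_ci).
    - by apply: measurable_funTS; exact: measurable_funeM.
    move=> w [KZ Aw]; rewrite -EFinM lee_fin subr0 -(path_increment X_ci) mulrC.
    move: KZ; rewrite /E /mkset /Z stopped_before// le_max [K <= 0]leNgt K0 orbF => KX.
    have X0 : 0 <= X t w by exact: le_trans (ltW K0) KX.
    rewrite ge_max; apply/andP; split; last by rewrite mulr_ge0// exprn_ge0.
    rewrite ler_pdivlMr ?exprn_gt0// [X t w ^+ 4]exprS; apply: ler_wpM2l => //.
    by rewrite ler_pXn2r// nnegrE ltW.
  apply: ge0_subset_integral => //; first exact: measurable_funeM.
  by move=> w _; rewrite mule_ge0.
rewrite ge0_integralZl//.
apply: (@le_trans _ _ ((K ^+ 3)^-1 * M)%:E).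
  rewrite EFinM lee_wpmul2l//; apply: (le_trans (increment_moment X_ci (lexx 0) t0)).
  rewrite subr0 lee_fin /M.
  have Kc0 : 0 <= Kc.
    by have := moment_bound_ge0 X_ci (lexx 0) ler01 ltr01; rewrite subr0 !expr1n mulr1 divr1.
  by rewrite ler_wpM2l// ler_pXn2r ?nnegrE// ltW.
rewrite lee_fin; apply: (@le_trans _ _ (e / 3)); last by rewrite lerDl ltW.
rewrite mulrC ler_pdivrMr ?exprn_gt0// mulrC -ler_pdivrMr//.
by apply: (le_trans MK); exact: ler_eXnr.
Qed.

End stopped_tails.

(** * Moments of the normal distribution *)

Section density.
Context {d} {T : measurableType d} {R : realType}.
Variables (m nu : {measure set T -> \bar R}) (g : T -> R).
Hypotheses (mg : measurable_fun setT g) (g0 : forall x, 0 <= g x).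
Hypothesis nuE : forall A, measurable A -> nu A = (\int[m]_(x in A) (g x)%:E)%E.

Import HBNNSimple.

Let integral_density_nnsfun (h : {nnsfun T >-> R}) :
  (\int[nu]_x (h x)%:E = \int[m]_x ((h x)%:E * (g x)%:E))%E.
Proof.
under [LHS]eq_integral do rewrite fimfunE -fsumEFin//.
rewrite [LHS]ge0_integral_fsum//; last 2 first.
  - by move=> r; exact/measurable_EFinP/measurableT_comp.
  - by move=> n x _; rewrite EFinM nnfun_muleindic_ge0.
under [RHS]eq_integral.
  move=> x xD; rewrite fimfunE -fsumEFin// muleC ge0_mule_fsumr; last first.
    by move=> r; rewrite EFinM nnfun_muleindic_ge0.
  over.
rewrite [RHS]ge0_integral_fsum//; last 2 first.
  - move=> r; apply/measurable_EFinP; apply: measurable_funM => //.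
    exact: measurable_funM.
  - by move=> n x _; rewrite EFinM mule_ge0 ?lee_fin// -lee_fin EFinM nnfun_muleindic_ge0.
apply: eq_fsbigr => r _; rewrite integralZl_indic_nnsfun//= integral_indic// setIT.
have [rneg|r0] := ltP r 0.
  rewrite preimage_nnfun0// measure0 mule0 integral0_eq// => x _.
  by rewrite indicE (_ : _ \in _ = false) ?mulr0 ?mule0//; apply: memNset.
rewrite nuE// integral_mkcond -ge0_integralZl//.
- apply: eq_integral => x _; rewrite epatch_indic/= -!EFinM.
  by congr EFin; ring.
- by apply/(measurable_restrictT _ _).1 => //; apply/measurable_EFinP; exact: measurable_funTS.
- by move=> x _; rewrite epatch_indic/= -EFinM lee_fin mulr_ge0.
Qed.

Lemma integral_density (f : T -> \bar R) :
  measurable_fun setT f -> (forall x, 0 <= f x)%E ->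
  (\int[nu]_x f x = \int[m]_x (f x * (g x)%:E))%E.
Proof.
move=> mf f0; pose f_ := nnsfun_approx measurableT mf.
transitivity (lim (\int[nu]_x (f_ n x)%:E @[n --> \oo])%E).
  rewrite -monotone_convergence//=.
  - apply: eq_integral => ? /[!inE] xD; apply/esym/cvg_lim => //=.
    exact: cvg_nnsfun_approx.
  - by move=> n; exact/measurable_EFinP/measurable_funTS.
  - by move=> n ? _; rewrite lee_fin.
  - by move=> ? _ ? ? mn; rewrite lee_fin; exact/lefP/nd_nnsfun_approx.
under eq_fun do rewrite integral_density_nnsfun.
rewrite -monotone_convergence//=.
- apply: eq_integral => x _; apply/cvg_lim => //.
  apply: cvgeZr => //; exact: cvg_nnsfun_approx.
- move=> n; apply/measurable_EFinP; apply: measurable_funM => //.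
- by move=> n ? _; rewrite mule_ge0 ?lee_fin.
- move=> x _ i j ij; rewrite lee_wpmul2r ?lee_fin//.
  exact/lefP/nd_nnsfun_approx.
Qed.

End density.

Section normal_moments.
Context {R : realType}.
Notation mu := (@lebesgue_measure R).

(** The exponential beats the fourth power at the price of doubling the standard
    deviation. *)
Lemma quartic_normal_pdf (s x : R) : 0 < s ->
  x ^+ 4 * normal_pdf 0 s x <= 64 * s ^+ 4 * normal_pdf 0 (2 * s) x.
Proof.
move=> s0; have s20 : 0 < 2 * s by rewrite mulr_gt0.
rewrite !normal_pdfE ?gt_eqF// /normal_fun subr0.
have -> : normal_peak (2 * s) = normal_peak s / 2.
  rewrite /normal_peak.
  have -> : (2 * s) ^+ 2 * pi *+ 2 = 2 ^+ 2 * (s ^+ 2 * pi *+ 2) by ring.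
  by rewrite sqrtrM ?sqr_ge0// sqrtr_sqr ger0_norm// invfM mulrC.
pose v := x ^+ 2 / s ^+ 2.
have E1 : - x ^+ 2 / (s ^+ 2 *+ 2) = - (v / 2).
  by rewrite /v mulNr -mulr_natr invfM mulrA.
have E2 : - x ^+ 2 / ((2 * s) ^+ 2 *+ 2) = - (v / 2) + (3 / 16 * v) * 2.
  by rewrite /v; field; rewrite gt_eqF.
rewrite E1 E2 expRD.
have v0 : 0 <= v by rewrite divr_ge0 ?sqr_ge0.
have xE : x ^+ 4 = v ^+ 2 * s ^+ 4.
  by rewrite /v; field; rewrite gt_eqF.
set E := expR (- (v / 2)).
have e_ge : v ^+ 2 <= 32 * expR (3 / 16 * v * 2).
  have z0 : 0 <= 3 / 16 * v * 2 by lra.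
  have := expR_ge1Dxn 1 z0; rewrite (_ : 2`!%:R = 2) => [?|]; last by rewrite !factS.
  have : 0 <= v ^+ 2 by rewrite sqr_ge0.
  lra.
rewrite xE.
have -> : v ^+ 2 * s ^+ 4 * (normal_peak s * E) = (normal_peak s * E * s ^+ 4) * v ^+ 2.
  by ring.
have -> : 64 * s ^+ 4 * (normal_peak s / 2 * (E * expR (3 / 16 * v * 2))) =
    (normal_peak s * E * s ^+ 4) * (32 * expR (3 / 16 * v * 2)) by field.
apply: ler_wpM2l e_ge; apply: mulr_ge0; last by apply: exprn_ge0; exact: ltW.
by apply: mulr_ge0; [exact: normal_peak_ge0|exact: expR_ge0].
Qed.

Lemma integral_normal_prob (s : R) (f : R -> \bar R) :
  measurable_fun setT f -> (forall x, 0 <= f x)%E ->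
  (\int[normal_prob 0 s]_x f x = \int[mu]_x (f x * (normal_pdf 0 s x)%:E))%E.
Proof.
move=> mf f0; apply: integral_density => //; first exact: measurable_normal_pdf.
exact: normal_pdf_ge0.
Qed.

(** The fourth moment is compared, without being computed, with the total mass
    of a wider normal density. *)
Lemma normal_fourth_moment (s : R) : 0 < s ->
  (\int[normal_prob 0 s]_x (x ^+ 4)%:E <= (64 * s ^+ 4)%:E)%E.
Proof.
move=> s0; have m4 : measurable_fun setT (fun x : R => x ^+ 4) by exact: measurable_funX.
rewrite integral_normal_prob; last 2 first.
- exact/measurable_EFinP.
- by move=> x; rewrite lee_fin exprn_even_ge0.
have mpdf (r : R) : measurable_fun setT (fun x => (normal_pdf 0 r x)%:E).
  by apply/measurable_EFinP; exact: measurable_normal_pdf.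
apply: (@le_trans _ _ (\int[mu]_x ((64 * s ^+ 4)%:E * (normal_pdf 0 (2 * s) x)%:E))%E).
  apply: ge0_le_integral => //.
  - by move=> x _; apply: mule_ge0; rewrite lee_fin ?normal_pdf_ge0// exprn_even_ge0.
  - apply: emeasurable_funM; first exact/measurable_EFinP.
    exact: mpdf.
  - by apply: measurable_funeM; exact: mpdf.
  - by move=> x _; rewrite -!EFinM lee_fin quartic_normal_pdf.
rewrite ge0_integralZl//.
- by rewrite integral_normal_pdf mule1.
- exact: mpdf.
- by move=> x _; rewrite lee_fin normal_pdf_ge0.
- by rewrite lee_fin mulr_ge0// exprn_ge0// ltW.
Qed.

(** The density is even. *)
Lemma normal_mean0 (s : R) : 0 < s ->
  (\int[normal_prob 0 s]_x (pos x)%:E = \int[normal_prob 0 s]_x (pos (- x))%:E)%E.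
Proof.
move=> s0; rewrite !integral_normal_prob//; try (by move=> x; exact: epos_ge0);
  try by apply: measurable_pos => //; exact: measurableT_comp.
pose h x : \bar R := ((pos x)%:E * (normal_pdf 0 s x)%:E)%E.
have mh : measurable_fun setT h.
  apply: emeasurable_funM; first exact: measurable_pos.
  by apply/measurable_EFinP; exact: measurable_normal_pdf.
transitivity (\int[pushforward mu (-%R : _ -> measurableTypeR R)]_x h x)%E.
  by apply: eq_measure_integral => A mA _; exact/esym/lebesgue_measureN.
rewrite ge0_integral_pushforward//=.
- rewrite preimage_setT; apply: eq_integral => x _; rewrite /h/=.
  by rewrite !normal_pdfE ?gt_eqF// /normal_fun !subr0 sqrrN.
- by move=> x _; rewrite mule_ge0 ?epos_ge0// lee_fin normal_pdf_ge0.
Qed.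

End normal_moments.

(** * Brownian motion has centred independent increments *)

Section brownian.
Context {d} {T : measurableType d} {R : realType} (P : probability T R).
Variables (B : R -> {RV P >-> R}) (B_bm : standard_brownian_motion B).

Let X (t : R) (w : T) : R := B t w.

Let mX t : measurable_fun setT (X t).
Proof. exact: measurable_funPT. Qed.

Let mI s u : measurable_fun setT (increment X s u).
Proof. exact: measurable_funB. Qed.

Definition increment_cylinders (t : nat -> R) (n : nat) : set (set T) :=
  [set E | exists A : nat -> set R, (forall i, measurable (A i)) /\
    E = [set w | forall i, (i < n)%N -> A i (increment X (t i) (t i.+1) w)]].

Lemma increment_cylinder_bigcap (t : nat -> R) n (A : nat -> set R) :
  [set w | forall i, (i < n)%N -> A i (increment X (t i) (t i.+1) w)] =
  \bigcap_(i : 'I_n) ((fun w => B (t i.+1) w - B (t i) w) @^-1` A i).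
Proof.
apply/seteqP; split => w /= Aw; first by move=> i _; exact: Aw.
by move=> i lt_in; exact: (Aw (Ordinal lt_in)).
Qed.

Lemma measurable_increment_cylinder (t : nat -> R) n (A : nat -> set R) :
  (forall i, measurable (A i)) ->
  measurable [set w | forall i, (i < n)%N -> A i (increment X (t i) (t i.+1) w)].
Proof.
move=> mA; rewrite increment_cylinder_bigcap; apply: fin_bigcap_measurable => // i _.
by rewrite -[X in measurable X]setTI; apply: mI.
Qed.

(** Independence of one increment from the sigma-algebra of the earlier ones on
    the same time grid. *)
Lemma increment_independent_cylinders (t : nat -> R) n E D : 0 <= t 0%N ->
  (forall i, (i <= n)%N -> t i < t i.+1) ->
  <<s increment_cylinders t n >> E -> measurable D ->
  P (E `&` increment X (t n) (t n.+1) @^-1` D) =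
    (P E * P (increment X (t n) (t n.+1) @^-1` D))%E.
Proof.
move=> t0 tlt FE mD; pose D' := increment X (t n) (t n.+1) @^-1` D.
have mD' : measurable D' by rewrite -[X in measurable X]setTI; apply: mI.
have PD0 : 0 <= fine (P D') by rewrite fine_ge0.
have PDE : P D' = (NngNum PD0)%:num%:E by rewrite fineK// fin_num_measure.
have prodE m (A : nat -> set R) : (m <= n.+1)%N -> (forall i, measurable (A i)) ->
    P [set w | forall i, (i < m)%N -> A i (increment X (t i) (t i.+1) w)] =
    (\big[*%E/1%E]_(i < m) P (increment X (t i) (t i.+1) @^-1` A i))%E.
  move=> mn mA; rewrite increment_cylinder_bigcap.
  apply: (@brownian_independent _ _ _ _ _ B_bm m t t0 _ (fun i : 'I_m => A i)) => //.
  by move=> i im; apply: tlt; rewrite -ltnS (leq_trans im).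
have scaleE F : mscale (NngNum PD0) P F = (P F * P D')%E.
  by rewrite /mscale -PDE muleC.
rewrite -/D' -scaleE; change (mrestr P mD' E = mscale (NngNum PD0) P E).
apply: (@g_sigma_algebra_measure_unique _ _ _ (increment_cylinders t n) _
    (fun=> setT)) => //.
- by move=> _ [A [mA ->]]; exact: measurable_increment_cylinder.
- move=> _; exists (fun=> setT); split => //.
  by apply/seteqP; split.
- by rewrite bigcup_const//; exists 0%N.
- move=> _ _ [A [mA ->]] [A' [mA' ->]]; exists (fun i => A i `&` A' i).
  split; first by move=> i; exact: measurableI.
  apply/seteqP; split => w /= => [[Aw A'w] i im|Aw].
    by split; [exact: Aw|exact: A'w].
  by split => i /Aw [].
- move=> _ [A [mA ->]].
  apply: etrans (esym (scaleE _)); rewrite prodE//.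
  pose A' i := if (i < n)%N then A i else D.
  transitivity (P [set w | forall i, (i < n.+1)%N -> A' i (increment X (t i) (t i.+1) w)]).
    congr (P _); apply/seteqP; split => w.
      move=> [Aw Dw] i; rewrite ltnS leq_eqVlt /A' => /orP[/eqP ->|im].
        by rewrite ltnn.
      by rewrite im; exact: Aw.
    move=> Aw; split => [i im|]; last by have := Aw n (ltnSn n); rewrite /A' ltnn.
    by have := Aw i (ltnW im); rewrite /A' im.
  rewrite prodE//; last by move=> i; rewrite /A'; case: ifP.
  rewrite big_ord_recr /= {2}/A' ltnn; congr (_ * _)%E.
  by apply: eq_bigr => i _; rewrite /A' ltn_ord.
- move=> _; apply: (@le_lt_trans _ _ 1%E); last exact: ltry.
  by apply: probability_le1; exact: measurableI.
Qed.

Lemma measurable_chain_path (t : nat -> R) n j : t 0%N = 0 -> (j <= n)%N ->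
  measurable_fun [set: g_sigma_algebraType (increment_cylinders t n)]
    (X (t j) : g_sigma_algebraType (increment_cylinders t n) -> R).
Proof.
pose T' := g_sigma_algebraType (increment_cylinders t n).
move=> t0; elim: j => [_|j IH jn].
  rewrite (_ : X (t 0%N) = cst 0); first exact: measurable_cst.
  by apply/funext => w; rewrite t0; exact: (brownian_start B_bm).
rewrite (_ : X (t j.+1) = (fun w => X (t j) w + increment X (t j) (t j.+1) w)).
  apply: measurable_funD; first by apply: IH; exact: ltnW.
  move=> _ A mA; rewrite setTI; apply: sub_sigma_algebra.
  (* the other increments are not constrained *)
  exists (fun i => if i == j then A else setT); split; first by move=> i; case: ifP.
  apply/seteqP; split => w /= => [Aw i _|/(_ j jn)]; last by rewrite eqxx.
  by case: eqP => // ->.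
by apply/funext => w; rewrite /increment addrC subrK.
Qed.

Definition path_cylinders (s : R) : set (set T) :=
  [set E | exists n (r : nat -> R) (A : nat -> set R),
    [/\ forall i, (i < n)%N -> 0 <= r i <= s, forall i, measurable (A i) &
        E = [set w | forall i, (i < n)%N -> A i (X (r i) w)]]].

(** Finitely many times in [[0, s]] are put on one increasing grid that starts at
    [0] and reaches [s] in its last step but one. *)
Lemma common_grid (s u : R) n (r : nat -> R) : 0 <= s -> s < u ->
  (forall i, (i < n)%N -> 0 <= r i <= s) ->
  exists (t : nat -> R) (m : nat), [/\ t 0%N = 0, t m = s, t m.+1 = u,
    forall i, (i <= m)%N -> t i < t i.+1 &
    forall i, (i < n)%N -> exists2 j, (j <= m)%N & r i = t j].
Proof.
move=> s0 su r_in.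
pose L := sort <=%R (undup (0 :: s :: [seq r i | i <- iota 0 n])).
have L_mem x : (x \in L) = (x \in 0 :: s :: [seq r i | i <- iota 0 n]).
  by rewrite mem_sort mem_undup.
have L_sorted : sorted <%R L by rewrite sort_lt_sorted undup_uniq.
have L_bound x : x \in L -> 0 <= x <= s.
  rewrite L_mem !inE => /or3P[/eqP ->|/eqP ->|/mapP[i]]; rewrite ?s0 ?lexx//.
  by rewrite mem_iota/= add0n => /r_in ? ->.
have L0 : 0 \in L by rewrite L_mem inE eqxx.
have Ls : s \in L by rewrite L_mem !inE eqxx orbT.
have L_size : (0 < size L)%N by case: (L) L0.
pose m := (size L).-1.
have mE : m.+1 = size L by rewrite prednK.
have mL : (m < size L)%N by rewrite -mE.
have nth_lt i j : (i < j)%N -> (j < size L)%N -> nth u L i < nth u L j.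
  by move=> ij jL; apply: (sorted_ltn_nth lt_trans) => //; rewrite inE// (ltn_trans ij).
have nth_le i j : (i <= j)%N -> (j < size L)%N -> nth u L i <= nth u L j.
  rewrite leq_eqVlt => /orP[/eqP ->//|ij jL]; exact/ltW/nth_lt.
(* the default value of [nth] is the grid time that follows [s] *)
exists (nth u L), m; split.
- apply/le_anti/andP; split.
    by rewrite -[leRHS](nth_index u L0) nth_le// index_mem.
  by have /andP[] := L_bound _ (mem_nth u L_size).
- apply/le_anti/andP; split.
    by have /andP[] := L_bound _ (mem_nth u mL).
  by rewrite -[leLHS](nth_index u Ls) nth_le ?mE// -ltnS mE index_mem.
- by rewrite nth_default// mE.
- move=> i; rewrite leq_eqVlt => /orP[/eqP ->|im]; last by apply: nth_lt; rewrite ?mE// -mE ltnS.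
  rewrite [ltRHS]nth_default ?mE//; apply: le_lt_trans su.
  by have /andP[] := L_bound _ (mem_nth u mL).
- move=> i im; have rL : r i \in L.
    by rewrite L_mem !inE map_f ?orbT// mem_iota.
  by exists (index (r i) L); [rewrite -ltnS mE index_mem|rewrite nth_index].
Qed.

(** Events that constrain the path at finitely many times of [[0, s]] form a
    pi-system, and each of them is determined by the increments on a grid of which
    [[s, u]] is the next interval. *)
Lemma brownian_increment_independent s u E D : 0 <= s -> s <= u ->
  <<s history X s >> E -> measurable D ->
  P (E `&` increment X s u @^-1` D) = (P E * P (increment X s u @^-1` D))%E.
Proof.
move=> s0 + FE mD; rewrite le_eqVlt => /orP[/eqP <-|su].
  have [D0|D0] := pselect (D 0).
    rewrite (_ : _ @^-1` D = setT) ?setIT ?probability_setT ?mule1//.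
    by apply/seteqP; split => // w _; rewrite /= /increment subrr.
  rewrite (_ : _ @^-1` D = set0) ?setI0 ?measure0 ?mule0//.
  by apply/seteqP; split => // w; rewrite /= /increment subrr.
pose D' := increment X s u @^-1` D.
have mD' : measurable D' by rewrite -[X in measurable X]setTI; apply: mI.
have PD0 : 0 <= fine (P D') by rewrite fine_ge0.
have PDE : P D' = (NngNum PD0)%:num%:E by rewrite fineK// fin_num_measure.
have scaleE F : mscale (NngNum PD0) P F = (P F * P D')%E.
  by rewrite /mscale -PDE muleC.
rewrite -/D' -scaleE; change (mrestr P mD' E = mscale (NngNum PD0) P E).
have {}FE : <<s path_cylinders s >> E.
  move: E FE; apply: sub_sigma_algebra2 => _ [r [A [rs mA ->]]].
  exists 1%N, (fun=> r), (fun=> A); split => //.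
  by apply/seteqP; split => w /= => [Aw i _//|/(_ 0%N isT)].
apply: (@g_sigma_algebra_measure_unique _ _ _ (path_cylinders s) _ (fun=> setT)) => //.
- move=> _ [n [r [A [_ mA ->]]]].
  rewrite (_ : mkset _ = \bigcap_(i : 'I_n) (X (r i) @^-1` A i)).
    apply: fin_bigcap_measurable => // i _.
    by rewrite -[X in measurable X]setTI; apply: mX.
  apply/seteqP; split => w /= Aw; first by move=> i _; exact: Aw.
  by move=> i lt_in; exact: (Aw (Ordinal lt_in)).
- move=> _; exists 0%N, (fun=> 0), (fun=> setT); split => //.
  by apply/seteqP; split.
- by rewrite bigcup_const//; exists 0%N.
- move=> _ _ [n [r [A [rs mA ->]]]] [n' [r' [A' [rs' mA' ->]]]].
  exists (n + n')%N, (fun i => if (i < n)%N then r i else r' (i - n)%N),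
    (fun i => if (i < n)%N then A i else A' (i - n)%N); split.
  + move=> i inn'; case: (ltnP i n) => [im|ni]; first exact: rs.
    by apply: rs'; rewrite ltn_subLR.
  + by move=> i; case: ifP.
  + apply/seteqP; split => w /= => [[Aw A'w] i inn'|Aw].
      case: (ltnP i n) => [im|ni]; first exact: Aw.
      by apply: A'w; rewrite ltn_subLR.
    split => i im; first by have := Aw i (ltn_addr _ im); rewrite im.
    by have := Aw (n + i)%N; rewrite ltn_add2l im ltnNge leq_addr/= addKn; apply.
- move=> _ [n [r [A [rs mA ->]]]].
  have [t [m [t0 tm tm1 tlt rt]]] := common_grid s0 su rs.
  apply: etrans (esym (scaleE _)); set G := mkset _.
  suff FG : <<s increment_cylinders t m >> G.
    have := increment_independent_cylinders _ tlt FG mD.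
    by rewrite t0 tm tm1 => /(_ (lexx 0)).
  rewrite /G.
  rewrite (_ : mkset _ = \bigcap_(i : 'I_n) (X (r i) @^-1` A i)).
    apply: (@fin_bigcap_measurable _ (g_sigma_algebraType (increment_cylinders t m))) => // i _.
    have [j jm ->] := rt i (ltn_ord i).
    by rewrite -[X in measurable X]setTI; apply: measurable_chain_path.
  apply/seteqP; split => w /= Aw; first by move=> i _; exact: Aw.
  by move=> i lt_in; exact: (Aw (Ordinal lt_in)).
- move=> _; apply: (@le_lt_trans _ _ 1%E); last exact: ltry.
  by apply: probability_le1; exact: measurableI.
Qed.

Lemma integral_brownian_increment s u (f : R -> \bar R) : 0 <= s -> s < u ->
  measurable_fun setT f -> (forall x, 0 <= f x)%E ->
  (\int[P]_w f (increment X s u w) =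
   \int[normal_prob 0 (Num.sqrt (u - s))]_x f x)%E.
Proof.
move=> s0 su mf f0.
have mI' : measurable_fun setT (increment X s u : T -> measurableTypeR R) by exact: mI.
have := @ge0_integral_pushforward _ _ _ _ _ _ mI' P setT f measurableT mf.
rewrite preimage_setT => <-//.
apply: eq_measure_integral => A mA _.
exact: (brownian_gaussian B_bm).
Qed.

Lemma brownian_centred_increments : centred_increments P X 64.
Proof.
split => //.
- exact: (brownian_start B_bm).
- exact: (brownian_continuous B_bm).
- exact: brownian_increment_independent.
- move=> s u s0; rewrite le_eqVlt => /orP[/eqP <-|su].
    by apply: eq_integral => w _; rewrite /increment subrr oppr0.
  have h0 : 0 < Num.sqrt (u - s) by rewrite sqrtr_gt0 subr_gt0.
  rewrite (@integral_brownian_increment s u (fun x => (pos x)%:E))//; last 2 first.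
  - exact: measurable_pos.
  - by move=> x; exact: epos_ge0.
  rewrite (@integral_brownian_increment s u (fun x => (pos (- x))%:E))//; last 2 first.
  - by apply: measurable_pos; exact: oppr_measurable.
  - by move=> x; exact: epos_ge0.
  exact: normal_mean0.
- move=> s u s0; rewrite le_eqVlt => /orP[/eqP <-|su].
    rewrite subrr expr0n mulr0 integral0_eq// => w _.
    by rewrite /increment subrr expr0n.
  have h0 : 0 < Num.sqrt (u - s) by rewrite sqrtr_gt0 subr_gt0.
  rewrite (@integral_brownian_increment s u (fun x => (x ^+ 4)%:E))//; last 2 first.
  - by apply/measurable_EFinP; exact: measurable_funX.
  - by move=> x; rewrite lee_fin exprn_even_ge0.
  apply: le_trans (normal_fourth_moment h0) _.
  by rewrite lee_fin (exprM _ 2 2) sqr_sqrtr// subr_ge0 ltW.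
Qed.

End brownian.

(** * Reflection, and the law at the hitting time *)

Section reflection.
Context {d} {T : measurableType d} {R : realType} (P : probability T R).

Lemma incrementN (X : R -> T -> R) s u w :
  increment (fun t w => - X t w) s u w = - increment X s u w.
Proof. by rewrite /increment opprD. Qed.

Lemma historyN (X : R -> T -> R) s : history (fun t w => - X t w) s `<=` history X s.
Proof.
move=> _ [r [A [rs mA ->]]]; exists r, (-%R @^-1` A); split => //.
by rewrite -[X in measurable X]setTI; exact: oppr_measurable.
Qed.

Lemma centred_incrementsN (X : R -> T -> R) K :
  centred_increments P X K -> centred_increments P (fun t w => - X t w) K.
Proof.
move=> X_ci; split.
- by move=> t; apply: measurableT_comp => //; exact: (path_measurable X_ci).
- by move=> w; rewrite (path_start X_ci) oppr0.
- move=> w; have := @path_continuous _ _ _ _ _ _ X_ci w => /subspace_continuousP X_cont.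
  by apply/subspace_continuousP => t t0; apply: (@cvgN _ R^o); exact: X_cont.
- move=> s u E D s0 su FE mD.
  have -> : increment (fun t w => - X t w) s u @^-1` D =
      increment X s u @^-1` (-%R @^-1` D).
    by apply/seteqP; split => w /=; rewrite incrementN.
  apply: (increment_independent X_ci) => //.
    exact: sub_sigma_algebra2 (@historyN X s) _ FE.
  by rewrite -[X in measurable X]setTI; exact: oppr_measurable.
- move=> s u s0 su; rewrite [RHS](eq_integral (fun w => (pos (increment X s u w))%:E)).
    rewrite (increment_mean X_ci)//.
    by apply: eq_integral => w _; rewrite incrementN.
  by move=> w _; rewrite incrementN opprK.
- move=> s u s0 su; rewrite (eq_integral (fun w => (increment X s u w ^+ 4)%:E)).
    exact: (increment_moment X_ci).
  by move=> w _; rewrite incrementN; congr EFin; ring.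
Qed.

Lemma hitting_timeN (X : R -> T -> R) b c :
  hitting_time (fun t w => - X t w) (fun t => - c t)%E (fun t => - b t)%E =
  hitting_time X b c.
Proof.
apply/funext => w; rewrite /hitting_time; congr ereal_inf.
apply/seteqP; split => _ [t [t0 ht] <-]; exists t => //; split => //; move: ht;
  rewrite EFinN !leeN2; tauto.
Qed.

End reflection.

Lemma boundary_pair_expanding (R : realType) (mu : probability (measurableTypeR R) R)
    (b c : R -> \bar R) :
  boundary_pair mu b c -> expanding_boundaries b c.
Proof.
move=> [bc_nonneg bc_nonpos bc_two].
have cst_lc (f : R -> \bar R) (l : \bar R) : (forall t, 0 < t -> f t = l) -> left_continuous f.
  move=> fl t t0; rewrite (fl t t0); apply: cvg_near_cst.
  rewrite near_withinE; have : \forall s \near t, 0 < s by exact: lt_nbhsr.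
  by apply: filterS => s s0 _; exact: fl.
have [sp|sp] := pselect (topological_support mu `<=` [set x | 0 <= x]).
  have [_ b_lc b_inc cE] := bc_nonneg sp; split => //; last exact: cst_lc cE.
  by move=> s t s0 st; rewrite !cE// (lt_le_trans s0 st).
have [sn|sn] := pselect (topological_support mu `<=` [set x | x <= 0]).
  have [bE _ c_lc c_dec] := bc_nonpos sn; split => //; last exact: cst_lc bE.
  by move=> s t s0 st; rewrite !bE// (lt_le_trans s0 st).
by have [[_ ? ?] [_ ? ?]] := bc_two sp sn.
Qed.

Section embedded_law.
Context {d} {T : measurableType d} {R : realType} (P : probability T R).
Variables (X : R -> T -> R) (K : R) (X_ci : centred_increments P X K).
Variables (b c : R -> \bar R) (bc : expanding_boundaries b c).
Variable mu : probability (measurableTypeR R) R.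

Local Notation A := (no_hit X b c).
Local Notation tau := (hitting_time X b c).
Local Notation Y := (hitting_value X b c).

Hypothesis tau_fin : {ae P, forall w, (tau w < +oo)%E}.
Hypothesis Y_law : forall D : set R, measurable D ->
  P [set w | (tau w < +oo)%E /\ D (Y w)] = mu D.

Let mY : measurable_fun setT (Y : T -> measurableTypeR R).
Proof. exact: (measurable_hitting_value X_ci bc). Qed.

(** Paths that never hit are negligible. *)
Lemma hitting_value_law D : measurable D -> P (Y @^-1` D) = mu D.
Proof.
move=> mD; rewrite -Y_law//; pose F := [set w | (tau w < +oo)%E].
have mF : measurable F.
  rewrite (_ : F = \bigcup_n ~` A n%:R).
    apply: bigcupT_measurable => n; apply: measurableC.
    exact: (measurable_no_hit X_ci bc).
  apply/seteqP; split => w.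
    rewrite /F/= => tau_w; exists (Num.truncn (fine (tau w))).+1 => //.
    move=> /no_hit_le_hitting_time; apply/negP; rewrite -ltNge.
    have tau_w' : tau w \is a fin_num by rewrite ge0_fin_numE// hitting_time_ge0.
    by rewrite -(fineK tau_w') lte_fin; exact: truncnS_gt.
  by move=> [n _ /hit_hitting_time_le tn]; apply: le_lt_trans tn _; exact: ltry.
have mYD : measurable (Y @^-1` D) by rewrite -[X in measurable X]setTI; exact: mY.
have F0 : P (~` F) = 0%E.
  by apply/negligibleP; [exact: measurableC|exact: tau_fin].
have null : P (Y @^-1` D `\` F) = 0%E.
  apply: (@subset_measure0 _ _ _ P _ (~` F)) F0 => //; first exact: measurableD.
  exact: measurableC.
have -> : P (Y @^-1` D) = (P (Y @^-1` D `\` F) + P (Y @^-1` D `&` F))%E.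
  exact: measureDI.
by rewrite null add0e setIC.
Qed.

Lemma ge0_integral_hitting_value (f : R -> \bar R) : measurable_fun setT f ->
  (forall x, 0 <= f x)%E -> (\int[P]_w f (Y w) = \int[mu]_x f x)%E.
Proof.
move=> mf f0; have := @ge0_integral_pushforward _ _ _ _ _ _ mY P setT f measurableT mf.
rewrite preimage_setT => <-//.
by apply: eq_measure_integral => D mD _; exact: hitting_value_law.
Qed.

(** The positive and the negative part of the mean cannot both be infinite when
    the mean is a real number, since [+oo - +oo] is [-oo]. *)
Lemma hitting_value_mean : mean mu \is a fin_num ->
  P.-integrable setT (EFin \o Y) /\ \int[P]_w Y w = fine (mean mu).
Proof.
pose p := (\int[P]_w (pos (Y w))%:E)%E; pose n := (\int[P]_w (pos (- Y w))%:E)%E.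
have p0 : (0 <= p)%E by apply: integral_ge0 => w _; exact: epos_ge0.
have n0 : (0 <= n)%E by apply: integral_ge0 => w _; exact: epos_ge0.
have mmu : mean mu = (p - n)%E.
  rewrite /mean integralE /p /n.
  rewrite (@ge0_integral_hitting_value (fun x => (pos x)%:E)); last 2 first.
  - exact: measurable_pos.
  - by move=> x; exact: epos_ge0.
  rewrite (@ge0_integral_hitting_value (fun x => (pos (- x))%:E)); last 2 first.
  - by apply: measurable_pos; exact: oppr_measurable.
  - by move=> x; exact: epos_ge0.
  by congr (_ - _)%E; apply: eq_integral => x _; rewrite ?funeposE ?funenegE EFin_max.
have meanP : (\int[P]_w (Y w)%:E = p - n)%E.
  rewrite integralE; congr (_ - _)%E; apply: eq_integral => x _;
  by rewrite ?funeposE ?funenegE EFin_max.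
move=> mean_fin; split; last by rewrite /Rintegral meanP mmu.
have [pf nf] : p \is a fin_num /\ n \is a fin_num.
  by move: mean_fin; rewrite mmu; move: (p) (n) p0 n0 => [?||] [?||].
have mYE : measurable_fun setT Y by exact: mY.
apply/integrableP; split; first exact/measurable_EFinP.
have -> : (\int[P]_w `|(EFin \o Y) w| = p + n)%E.
  rewrite -ge0_integralD//.
  - apply: eq_integral => w _ /=; rewrite -EFinD; congr EFin.
    have [Y0|Y0] := leP 0 (Y w).
      have -> : pos (- Y w) = 0 by apply/max_idPr; rewrite oppr_le0.
      by rewrite addr0 ger0_norm.
    have -> : pos (- Y w) = - Y w by apply/max_idPl; rewrite oppr_ge0 ltW.
    by rewrite add0r ltr0_norm.
  - by move=> w _; exact: epos_ge0.
  - exact: measurable_pos.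
  - by move=> w _; exact: epos_ge0.
  - by apply: measurable_pos; exact: measurableT_comp.
have : (p + n)%E \is a fin_num by rewrite fin_numD pf.
by rewrite ge0_fin_numE// adde_ge0.
Qed.

End embedded_law.

Theorem corollary12 (d : measure_display) (T : measurableType d) (R : realType)
    (P : probability T R) (B : R -> {RV P >-> R})
    (mu : probability (measurableTypeR R) R) (b c : R -> \bar R) :
  standard_brownian_motion B ->
  mu [set 0] = 0%E ->
  embedding_pair B mu b c ->
  let tau := hitting_time B b c in
  let time : set R := [set t | 0 <= t] in
  [/\ mean mu = 0%E ->
        uniformly_integrable P time (stopped B tau),
      (0 < mean mu < +oo)%E ->
        uniformly_integrable P time (fun t w => Num.max (stopped B tau t w) 0) &
      (-oo < mean mu < 0)%E ->
        uniformly_integrable P time (fun t w => Num.max (- stopped B tau t w) 0)].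
Proof.
move=> B_bm _ [/boundary_pair_expanding bc tau_fin Y_law] tau time.
pose X (t : R) (w : T) : R := B t w.
have X_ci : centred_increments P X 64 := brownian_centred_increments B_bm.
have NX_ci := centred_incrementsN X_ci.
have Nbc := expanding_boundariesN bc.
have meanE := hitting_value_mean X_ci bc tau_fin Y_law.
have time0 : time !=set0 by exists 0; rewrite /time /=.
have mS t : time t -> measurable_fun setT (stopped B tau t).
  exact: (measurable_stopped X_ci bc).
have mSp t : time t -> measurable_fun setT (fun w => pos (stopped B tau t w)).
  by move=> t0; apply/measurable_EFinP; apply: measurable_pos; exact: mS.
have mSn t : time t -> measurable_fun setT (fun w => pos (- stopped B tau t w)).
  move=> t0; apply/measurable_EFinP; apply: measurable_pos.
  by apply: measurableT_comp => //; exact: mS.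
have tails : mean mu \is a fin_num -> (0 <= mean mu)%E ->
    uniform_tails P time (fun t w => pos (stopped B tau t w)).
  move=> /meanE[Y_int Y_mean] mean0.
  apply: (stopped_pos_uniform_tails X_ci bc tau_fin Y_int).
  by rewrite Y_mean fine_ge0.
have Ntails : mean mu \is a fin_num -> (mean mu <= 0)%E ->
    uniform_tails P time (fun t w => pos (- stopped B tau t w)).
  move=> /meanE[Y_int Y_mean] mean0.
  have NtauE := hitting_timeN X b c.
  have NYE : hitting_value (fun t w => - X t w) (fun t => - c t)%E (fun t => - b t)%E =
      (fun w => - hitting_value X b c w).
    by apply/funext => w; rewrite /hitting_value NtauE.
  have := @stopped_pos_uniform_tails _ _ _ _ _ _ NX_ci _ _ Nbc.
  rewrite NtauE NYE; apply => //.
    by have := integrableN Y_int; apply: eq_integrable.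
  under eq_Rintegral do rewrite -mulN1r.
  by rewrite RintegralZl// Y_mean mulN1r oppr_ge0 fine_le0.
split.
- move=> mean0; apply: (uniform_tails_integrable time0 mS).
  by apply: (uniform_tails_norm mS); [apply: tails|apply: Ntails]; rewrite mean0.
- move=> /andP[mean_gt0 mean_lty]; apply: (uniform_tails_integrable time0 mSp).
  by apply: tails; [rewrite ge0_fin_numE// ltW|exact: ltW].
- move=> /andP[mean_gtNy mean_lt0]; apply: (uniform_tails_integrable time0 mSn).
  apply: Ntails; last exact: ltW.
  by rewrite fin_numE -ltNye -ltey mean_gtNy (lt_trans mean_lt0)// ltry.
Qed.
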